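(* Let $M$ be a loop-free matroid on $[n]$, $\mathcal{C}_L$ a linear class of circuits of $M$, and $\mathbf{K}$ a field. For every element $x$ of $M$ there is a splitting short exact sequence of $\mathbf{K}$-vector spaces $$0\to\operatorname{Z}(M\setminus x,\mathcal{C}_L\setminus x)\xrightarrow{\ \mathfrak{i}_x\ }\operatorname{Z}(M,\mathcal{C}_L)\xrightarrow{\ \mathfrak{p}_x\ }\operatorname{Z}(M/x,\mathcal{C}_L/x)\to 0,$$ where $\mathfrak{i}_x$ is the unique linear map with $\mathfrak{i}_x(e_I)=e_I$ for every independent set $I$ of $M\setminus x$, and $\mathfrak{p}_x$ is the unique linear map with, for every $I\subseteq[n]$: $\mathfrak{p}_xe_I=e_{I\setminus x}$ if $x\in I$; $\mathfrak{p}_xe_I=\pm e_{I\setminus y}$ if some $y\in I$ satisfies $\{x,y\}\in\mathcal{C}_L$ (the sign being that of the permutation obtained by replacing $y$ by $x$ in $I$); and $\mathfrak{p}_xe_I=0$ otherwise.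
   Context: Linear class: $\mathcal{C}_L\subseteq\mathcal{C}(M)$ such that whenever $C_1,C_2\in\mathcal{C}_L$ satisfy $\operatorname{r}(C_1)+\operatorname{r}(C_2)=\operatorname{r}(C_1\cup C_2)+\operatorname{r}(C_1\cap C_2)$, every circuit of $M$ in $C_1\cup C_2$ is in $\mathcal{C}_L$. $\mathcal{C}_L\setminus x=\{C\in\mathcal{C}_L:x\notin C\}$; for a non-loop $x$, $\mathcal{C}_L/x=\{C\setminus x: x\in C\in\mathcal{C}_L\}\cup\{C\in\mathcal{C}_L:x\notin\operatorname{cl}_M(C)\}$; these are linear classes of $M\setminus x$, $M/x$. For a matroid $M$ on a linearly ordered finite set $S$ with linear class $\mathcal{C}_L$: $e_X=e_{i_1}\wedge\dots\wedge e_{i_m}$ in the exterior algebra on $\{e_s\}_{s\in S}$ for $X=\{i_1<\dots<i_m\}$, $e_\emptyset=1$; $\partial e_X=\sum_j(-1)^je_{X\setminus i_j}$, $\partial e_\emptyset=0$. $\operatorname{OS}(N)$ of a matroid $N$ is the exterior algebra modulo the ideal generated by $\partial e_C$ ($C$ circuit, $|C|>1$) and $e_C$ ($C$ circuit). The extended lift $N$ on $S\cup\{p\}$ ($p$ new) is the dual of the single-element extension $N^\star$ of $M^\star$ with $p\in\operatorname{cl}_{N^\star}(H)$ iff $S\setminus H\in\mathcal{C}_L$, for each hyperplane $H$ of $M^\star$. The bias algebra is $\operatorname{Z}(M,\mathcal{C}_L)=\operatorname{OS}(N)/\langle e_p\rangle$.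
   Formalization: Split exactness is shown iff no {x,y} is in C_L (false otherwise: two parallel elements); i_x injective, p_x onto hold always. Both nonzero rules for p_x carry the sign of moving x to the front (or back), 1 if x is first (last); the unsigned rule fails for U_{2,3}, x=2. The y-rule is for x not in I. *)

(* Defs.v *)
From HB Require Import structures.
From Stdlib Require ClassicalEpsilon.
From mathcomp Require Import all_boot all_order all_algebra all_field ring.

Set Implicit Arguments.
Unset Strict Implicit.
Unset Printing Implicit Defensive.

Import GRing.Theory.
Local Open Scope ring_scope.
Local Open Scope quotient_scope.

(* A matroid on a finite set [ground] of ordinals, given by its rank function;
   by [rk_ground] elements outside the ground set do not contribute, which lets
   the rank axioms be stated for all subsets of 'I_n. *)
Record matroid (n : nat) := Matroid {
  ground : {set 'I_n};
  rk : {set 'I_n} -> nat;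
  rk_ground : forall A, rk (A :&: ground) = rk A;
  rk_card : forall A, (rk A <= #|A|)%N;
  rk_mono : forall A B : {set 'I_n}, A \subset B -> (rk A <= rk B)%N;
  rk_submod : forall A B, (rk (A :|: B) + rk (A :&: B) <= rk A + rk B)%N
}.

Section Matroid.
Variable n : nat.
Implicit Types (M : matroid n) (A B C H I : {set 'I_n}) (x y : 'I_n).

Definition indep M I := (I \subset ground M) && (rk M I == #|I|).

Definition circuits M : {set {set 'I_n}} :=
  [set C | minset [pred A : {set 'I_n} | (A \subset ground M) && ~~ indep M A] C].

Definition cl M A := [set x in ground M | rk M (x |: A) == rk M A].

Definition hyperplane M H :=
  [&& H \subset ground M, cl M H == H & (rk M H).+1 == rk M (ground M)].

Definition loopfree M := [forall x in ground M, [set x] \notin circuits M].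

Lemma rk_le M A B : (rk M (A :|: B) <= rk M A + rk M B)%N.
Proof. exact: leq_trans (leq_addr _ _) (rk_submod M A B). Qed.

Lemma rk0 M : rk M set0 = 0%N.
Proof. by apply/eqP; rewrite -leqn0 -(cards0 'I_n) rk_card. Qed.

Section Deletion.
Variables (M : matroid n) (x : 'I_n).

Fact delete_ground A :
  rk M ((A :&: (ground M :\ x)) :\ x) = rk M (A :\ x).
Proof.
by rewrite -[RHS]rk_ground; congr rk; apply/setP=> z; rewrite !inE; case: eqP;
   rewrite ?andbF.
Qed.

Fact delete_card A : (rk M (A :\ x) <= #|A|)%N.
Proof. exact: leq_trans (rk_card M _) (subset_leq_card (subD1set _ _)). Qed.

Fact delete_mono A B : A \subset B -> (rk M (A :\ x) <= rk M (B :\ x))%N.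
Proof. by move=> sAB; apply/rk_mono/setSD. Qed.

Fact delete_submod A B :
  (rk M ((A :|: B) :\ x) + rk M ((A :&: B) :\ x)
     <= rk M (A :\ x) + rk M (B :\ x))%N.
Proof. by rewrite setDUl setDIl rk_submod. Qed.

Definition delete :=
  Matroid delete_ground delete_card delete_mono delete_submod.
End Deletion.

Section Contraction.
Variables (M : matroid n) (x : 'I_n).
Let crk A := (rk M (x |: A) - rk M [set x])%N.

Fact contract_ground A : crk (A :&: (ground M :\ x)) = crk A.
Proof.
rewrite /crk; congr subn; rewrite -[LHS]rk_ground -[RHS]rk_ground.
by congr rk; apply/setP=> z; rewrite !inE; case: eqP => //= _; case: (z \in A);
  case: (z \in ground M).
Qed.

Fact contract_card A : (crk A <= #|A|)%N.
Proof. by rewrite leq_subLR (leq_trans (rk_le M _ _)) // leq_add2l rk_card. Qed.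

Fact contract_mono A B : A \subset B -> (crk A <= crk B)%N.
Proof. by move=> sAB; apply/leq_sub2r/rk_mono/setUS. Qed.

Fact contract_submod A B :
  (crk (A :|: B) + crk (A :&: B) <= crk A + crk B)%N.
Proof.
have le1 D : (rk M [set x] <= rk M (x |: D))%N by apply/rk_mono/subsetUl.
rewrite -(leq_add2r (rk M [set x] + rk M [set x])) addnACA [leqRHS]addnACA.
rewrite !subnK // setUIr (_ : x |: (A :|: B) = (x |: A) :|: (x |: B)).
  exact: rk_submod.
by apply/setP=> z; rewrite !inE; case: (z == x).
Qed.

Definition contract :=
  Matroid contract_ground contract_card contract_mono contract_submod.
End Contraction.

Section Dual.
Variable M : matroid n.
Let E := ground M.
Let drk A := (#|A :&: E| + rk M (E :\: A) - rk M E)%N.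

Let drk_le A : (rk M E <= #|A :&: E| + rk M (E :\: A))%N.
Proof.
rewrite -{1}(setID E A) (leq_trans (rk_le M _ _)) // leq_add2r setIC.
exact: rk_card.
Qed.

Fact dual_ground A : drk (A :&: E) = drk A.
Proof.
rewrite /drk -setIA setIid; congr (_ + rk M _ - _)%N.
by apply/setP=> z; rewrite !inE; case: (z \in E); rewrite ?andbF ?andbT.
Qed.

Fact dual_card A : (drk A <= #|A|)%N.
Proof.
rewrite leq_subLR addnC leq_add ?rk_mono ?subsetDl //.
exact: subset_leq_card (subsetIl _ _).
Qed.

Fact dual_mono A B : A \subset B -> (drk A <= drk B)%N.
Proof.
move=> sAB; apply: leq_sub2r.
have -> : E :\: A = (E :\: B) :|: (E :&: (B :\: A)).
  apply/setP=> z; move/subsetP/(_ z): sAB; rewrite !inE.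
  by case: (z \in A) => [->|_] //; case: (z \in B); rewrite ?andbF ?andbT ?orbF.
apply: leq_trans (_ : #|A :&: E| + (rk M (E :\: B) + #|E :&: (B :\: A)|) <= _)%N.
  rewrite leq_add2l (leq_trans (rk_le M _ _)) // leq_add2l; exact: rk_card.
rewrite addnCA addnC leq_add2r -(cardsID A (B :&: E)) leq_add //;
  apply/subset_leq_card/subsetP=> z; rewrite !inE.
  by case/andP=> zA ->; rewrite zA (subsetP sAB).
by case/andP=> -> /andP[-> ->].
Qed.

Fact dual_submod A B : (drk (A :|: B) + drk (A :&: B) <= drk A + drk B)%N.
Proof.
rewrite -(leq_add2r (rk M E + rk M E)) addnACA [leqRHS]addnACA.
rewrite !subnK ?drk_le // addnACA [leqRHS]addnACA leq_add //.
  by rewrite setIUl setIIl cardsUI.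
by rewrite setDUr setDIr addnC rk_submod.
Qed.

Definition dual := Matroid dual_ground dual_card dual_mono dual_submod.
End Dual.

Fact null_ground A : (fun _ : {set 'I_n} => 0%N) (A :&: set0) = 0%N.
Proof. by []. Qed.

Definition null_matroid : matroid n :=
  @Matroid n set0 (fun _ => 0%N) null_ground (fun _ => isT)
    (fun _ _ _ => isT) (fun _ _ => isT).

Definition linear_class M (CL : {set {set 'I_n}}) : Prop :=
  CL \subset circuits M /\
  forall C1 C2, C1 \in CL -> C2 \in CL ->
    (rk M C1 + rk M C2 = rk M (C1 :|: C2) + rk M (C1 :&: C2))%N ->
    forall C, C \in circuits M -> C \subset C1 :|: C2 -> C \in CL.

Definition lc_delete (CL : {set {set 'I_n}}) x := [set C in CL | x \notin C].

Definition lc_contract M (CL : {set {set 'I_n}}) x :=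
  [set C :\ x | C in CL & x \in C] :|: [set C in CL | x \notin cl M C].

End Matroid.

(* A set of elements of S viewed in S + p, where p is [ord_max : 'I_n.+1]. *)
Definition up n (A : {set 'I_n}) : {set 'I_n.+1} := lift ord_max @: A.

(* [N] is a single-element extension of [M] by p = [ord_max].  As usual for
   extensions prescribed on hyperplanes, p must not be a coloop of [N]: otherwise
   the empty linear class would be realized both by the free extension and by
   the direct sum of [M] and a coloop. *)
Definition single_extension n (M : matroid n) (N : matroid n.+1) : Prop :=
  [/\ ground N = ord_max |: up (ground M),
      forall A, rk N (up A) = rk M A
    & ord_max \in cl N (up (ground M))].

Definition is_lift_extension n (M : matroid n) (CL : {set {set 'I_n}})
    (Ns : matroid n.+1) : Prop :=
  single_extension (dual M) Ns /\
  forall H, hyperplane (dual M) H ->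
    (ord_max \in cl Ns (up H)) = (ground M :\: H \in CL).

(* For a linear class, such an extension exists and its rank function is unique
   (Crapo). *)
Definition extended_lift n (M : matroid n) (CL : {set {set 'I_n}}) :
    matroid n.+1 :=
  dual (ClassicalEpsilon.epsilon (inhabits (null_matroid n.+1))
          (is_lift_extension M CL)).

Section Exterior.
Variables (K : fieldType) (n : nat) (E : {set 'I_n}).

Local Notation subE := {X : {set 'I_n} | X \subset E}.

(* The exterior algebra on {e_s : s in E}: a family of coefficients indexed by
   the monomials e_X, X a subset of E. *)
Definition exterior : Type := {ffun subE -> K^o}.

HB.instance Definition _ := Vector.on exterior.

Definition inversions (X Y : {set 'I_n}) : nat :=
  \sum_(i in X) \sum_(j in Y) (j < i)%N.

(* The coefficient of e_Z in the product e_X e_Y. *)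
Definition ext_coef (X Y Z : {set 'I_n}) : K :=
  if [disjoint X & Y] && (X :|: Y == Z) then (-1) ^+ inversions X Y else 0.

Definition ext_mul (f g : exterior) : exterior :=
  [ffun Z : subE => \sum_(X : subE) \sum_(Y : subE)
     ext_coef (val X) (val Y) (val Z) * ((f X : K) * (g Y : K))].

(* The monomial e_X; it is 0 if X is not a subset of E. *)
Definition ext_mon (X : {set 'I_n}) : exterior :=
  [ffun Z : subE => (val Z == X)%:R].

Fact disjointUl (X Y V : {set 'I_n}) :
  [disjoint X :|: Y & V] = [disjoint X & V] && [disjoint Y & V].
Proof. by rewrite -!setI_eq0 setIUl setU_eq0. Qed.

Fact disjointUr (X Y V : {set 'I_n}) :
  [disjoint X & Y :|: V] = [disjoint X & Y] && [disjoint X & V].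
Proof. by rewrite -!setI_eq0 setIUr setU_eq0. Qed.

Fact sum_setU (X Y : {set 'I_n}) (F : 'I_n -> nat) : [disjoint X & Y] ->
  (\sum_(i in X :|: Y) F i = \sum_(i in X) F i + \sum_(i in Y) F i)%N.
Proof.
by move=> dXY; rewrite -bigU //; apply: eq_bigl => i; rewrite !inE.
Qed.

Fact inversionsUl (X Y V : {set 'I_n}) : [disjoint X & Y] ->
  inversions (X :|: Y) V = (inversions X V + inversions Y V)%N.
Proof. exact: sum_setU. Qed.

Fact inversionsUr (X Y V : {set 'I_n}) : [disjoint Y & V] ->
  inversions X (Y :|: V) = (inversions X Y + inversions X V)%N.
Proof.
move=> dYV; rewrite /inversions -big_split /=.
by apply: eq_bigr => i _; rewrite sum_setU.
Qed.

Fact inversions0l X : inversions set0 X = 0%N.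
Proof. by rewrite /inversions big_set0. Qed.

Fact inversions0r X : inversions X set0 = 0%N.
Proof. by rewrite /inversions big1 // => i _; rewrite big_set0. Qed.

Fact ext_coef_sum (X Y : subE) (F : {set 'I_n} -> K) :
  \sum_(Z : subE) ext_coef (val X) (val Y) (val Z) * F (val Z) =
  if [disjoint val X & val Y]
  then (-1) ^+ inversions (val X) (val Y) * F (val X :|: val Y) else 0.
Proof.
have sXY : val X :|: val Y \subset E by rewrite subUset (valP X) (valP Y).
rewrite (bigD1 (exist (fun X : {set 'I_n} => X \subset E) _ sXY)) //= /ext_coef eqxx andbT big1 ?addr0.
  by case: ifP; rewrite // mul0r.
move=> Z neZ; rewrite (_ : (_ == val Z) = false) ?andbF ?mul0r //.
by apply: contraNF neZ => /eqP eqZ; rewrite -val_eqE /= -eqZ.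
Qed.

Fact ext_coefA (X Y V W : subE) :
  \sum_(Z : subE) ext_coef (val X) (val Y) (val Z)
                  * ext_coef (val Z) (val V) (val W) =
  \sum_(Z : subE) ext_coef (val Y) (val V) (val Z)
                  * ext_coef (val X) (val Z) (val W).
Proof.
rewrite (ext_coef_sum X Y (fun Z => ext_coef Z (val V) (val W))).
rewrite (ext_coef_sum Y V (fun Z => ext_coef (val X) Z (val W))).
rewrite /ext_coef -setUA; case: (_ == val W); last first.
  by rewrite !andbF !mulr0 !if_same.
rewrite !andbT disjointUl disjointUr.
case dXY: [disjoint val X & val Y] => /=; last by rewrite mulr0 if_same.
case dYV: [disjoint val Y & val V] => /=; last by rewrite andbF mulr0.
rewrite andbT; case: ifP => dXV; last by rewrite !mulr0.
rewrite inversionsUl // inversionsUr // !exprD; ring.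
Qed.

Fact sum_single (W : zmodType) (I : finType) (i : I) (F : I -> W) :
  (forall j, j != i -> F j = 0) -> \sum_j F j = F i.
Proof. by move=> F0; rewrite (bigD1 i) //= big1 ?addr0. Qed.

Fact ext_mulA : associative ext_mul.
Proof.
move=> f g h; apply/ffunP=> W; rewrite !ffunE.
pose t X Y V : K := (f X : K) * ((g Y : K) * (h V : K)).
transitivity (\sum_(X : subE) \sum_(Y : subE) \sum_(V : subE)
  (\sum_(Z : subE) ext_coef (val Y) (val V) (val Z)
                  * ext_coef (val X) (val Z) (val W)) * t X Y V).
  apply: eq_bigr => X _.
  transitivity (\sum_(Z : subE) \sum_(Y : subE) \sum_(V : subE)
      ext_coef (val Y) (val V) (val Z) * ext_coef (val X) (val Z) (val W)
      * t X Y V).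
    apply: eq_bigr => Z _; rewrite ffunE !mulr_sumr; apply: eq_bigr => Y _.
    rewrite !mulr_sumr; apply: eq_bigr => V _; rewrite /t; ring.
  rewrite exchange_big; apply: eq_bigr => Y _.
  by rewrite exchange_big; apply: eq_bigr => V _; rewrite mulr_suml.
transitivity (\sum_(V : subE) \sum_(X : subE) \sum_(Y : subE)
  (\sum_(Z : subE) ext_coef (val X) (val Y) (val Z)
                  * ext_coef (val Z) (val V) (val W)) * t X Y V).
  rewrite [RHS]exchange_big; apply: eq_bigr => X _.
  rewrite [RHS]exchange_big; apply: eq_bigr => Y _.
  by apply: eq_bigr => V _; rewrite ext_coefA.
rewrite [RHS]exchange_big; apply: eq_bigr => V _.
transitivity (\sum_(Z : subE) \sum_(X : subE) \sum_(Y : subE)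
    ext_coef (val X) (val Y) (val Z) * ext_coef (val Z) (val V) (val W)
    * t X Y V).
  rewrite [RHS]exchange_big; apply: eq_bigr => X _.
  by rewrite [RHS]exchange_big; apply: eq_bigr => Y _; rewrite mulr_suml.
apply: eq_bigr => Z _; rewrite ffunE mulr_suml mulr_sumr; apply: eq_bigr => X _.
rewrite mulr_suml mulr_sumr; apply: eq_bigr => Y _; rewrite /t; ring.
Qed.

Fact ext_mon_mul (X Y : {set 'I_n}) : X \subset E -> Y \subset E ->
  ext_mul (ext_mon X) (ext_mon Y) =
  if [disjoint X & Y] then (-1) ^+ inversions X Y *: ext_mon (X :|: Y) else 0.
Proof.
move=> sX sY; apply/ffunP=> Z.
pose sub := fun A : {set 'I_n} => A \subset E.
rewrite ffunE (sum_single (i := exist sub X sX)); last first.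
  move=> A neA; rewrite big1 // => B _; rewrite !ffunE.
  rewrite (_ : (val A == X) = false) ?mul0r ?mulr0 //.
  by apply: contraNF neA => /eqP eqA; rewrite -val_eqE /= -eqA.
rewrite (sum_single (i := exist sub Y sY)); last first.
  move=> B neB; rewrite !ffunE (_ : (val B == Y) = false) ?mulr0 //.
  by apply: contraNF neB => /eqP eqB; rewrite -val_eqE /= -eqB.
rewrite !ffunE /= !eqxx !mulr1 /ext_coef eq_sym.
case: [disjoint X & Y] => /=; last by rewrite ffunE.
rewrite !ffunE; case: (_ == _) => /=; last by rewrite scaler0.
by rewrite /GRing.scale /= mulr1.
Qed.

Fact ext_mulDl : left_distributive ext_mul +%R.
Proof.
move=> f g h; apply/ffunP=> W; rewrite !ffunE -big_split; apply: eq_bigr => X _.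
rewrite -big_split; apply: eq_bigr => Y _ /=; rewrite ffunE; ring.
Qed.

Fact ext_mulDr : right_distributive ext_mul +%R.
Proof.
move=> f g h; apply/ffunP=> W; rewrite !ffunE -big_split; apply: eq_bigr => X _.
rewrite -big_split; apply: eq_bigr => Y _ /=; rewrite ffunE; ring.
Qed.

Fact ext_scaleAl (a : K) (f g : exterior) :
  a *: ext_mul f g = ext_mul (a *: f) g.
Proof.
apply/ffunP=> W; rewrite !ffunE scaler_sumr; apply: eq_bigr => X _.
rewrite scaler_sumr; apply: eq_bigr => Y _; rewrite ffunE /GRing.scale /=; ring.
Qed.

Fact ext_scaleAr (a : K) (f g : exterior) :
  a *: ext_mul f g = ext_mul f (a *: g).
Proof.
apply/ffunP=> W; rewrite !ffunE scaler_sumr; apply: eq_bigr => X _.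
rewrite scaler_sumr; apply: eq_bigr => Y _; rewrite ffunE /GRing.scale /=; ring.
Qed.

Fact ext_sum_mon (f : exterior) : f = \sum_(X : subE) (f X : K) *: ext_mon (val X).
Proof.
apply/ffunP=> Z; rewrite sum_ffunE (sum_single (i := Z)).
  by rewrite !ffunE eqxx [RHS]mulr1.
move=> X neX; rewrite !ffunE (_ : (_ == _) = false) ?scaler0 //.
by rewrite val_eqE eq_sym (negbTE neX).
Qed.

Fact ext_mul1 : left_id (ext_mon set0) ext_mul.
Proof.
move=> f; apply/ffunP=> Z; rewrite ffunE.
pose sub := fun A : {set 'I_n} => A \subset E.
rewrite (sum_single (i := exist sub set0 (sub0set E))).
  rewrite (sum_single (i := Z)).
    rewrite ffunE /ext_coef /= set0U !eqxx -setI_eq0 set0I eqxx inversions0l.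
    by rewrite !mul1r.
  move=> Y neY; rewrite /ext_coef /= set0U val_eqE (negbTE neY) andbF mul0r //.
move=> X neX; rewrite big1 // => Y _; rewrite ffunE (_ : (_ == _) = false).
  by rewrite mul0r mulr0.
by apply: contraNF neX => /eqP eqX; rewrite -val_eqE /= -eqX.
Qed.

Fact ext_mulr1 : right_id (ext_mon set0) ext_mul.
Proof.
move=> f; apply/ffunP=> Z; rewrite ffunE exchange_big.
pose sub := fun A : {set 'I_n} => A \subset E.
rewrite (sum_single (i := exist sub set0 (sub0set E))).
  rewrite (sum_single (i := Z)).
    rewrite ffunE /ext_coef /= setU0 !eqxx -setI_eq0 setI0 eqxx inversions0r.
    by rewrite mulr1 mul1r.
  move=> Y neY; rewrite /ext_coef /= setU0 val_eqE (negbTE neY) andbF mul0r //.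
move=> X neX; rewrite big1 // => Y _; rewrite !ffunE (_ : (val X == _) = false).
  by rewrite !mulr0.
by apply: contraNF neX => /eqP eqX; rewrite -val_eqE /= -eqX.
Qed.

Fact ext_one_neq0 : ext_mon set0 != 0.
Proof.
pose sub := fun A : {set 'I_n} => A \subset E.
apply/eqP=> /ffunP/(_ (exist sub set0 (sub0set E))).
by rewrite !ffunE eqxx => /eqP; rewrite oner_eq0.
Qed.

HB.instance Definition _ := GRing.Zmodule_isNzRing.Build exterior
  ext_mulA ext_mul1 ext_mulr1 ext_mulDl ext_mulDr ext_one_neq0.
HB.instance Definition _ := GRing.Lmodule_isLalgebra.Build K exterior ext_scaleAl.
HB.instance Definition _ := GRing.Lalgebra_isAlgebra.Build K exterior ext_scaleAr.
HB.instance Definition _ := Algebra_isFalgebra.Build K exterior.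

End Exterior.

Section ExteriorMonomials.
Variables (K : fieldType) (n : nat) (E : {set 'I_n}).

Lemma ext_mon_prod (X : {set 'I_n}) : X \subset E ->
  ext_mon K E X = \prod_(i <- enum X) ext_mon K E [set i].
Proof.
have prodE (s : seq 'I_n) : sorted ltn (map val s) -> [set:: s] \subset E ->
    \prod_(i <- s) ext_mon K E [set i] = ext_mon K E [set:: s].
  elim: s => [|i s IHs] /= ss sE.
    by rewrite big_nil; congr ext_mon; apply/setP=> j; rewrite !inE.
  have sE' : [set:: s] \subset E.
    by apply: subset_trans sE; apply/subsetP=> j; rewrite !inE orbC => ->.
  have iE : [set i] \subset E by rewrite sub1set (subsetP sE) // !inE eqxx.
  rewrite big_cons (IHs (path_sorted ss)) // [LHS]ext_mon_mul //.
  have lt_i j : j \in s -> (i < j)%N.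
    move=> js; have /allP/(_ (val j)) := order_path_min ltn_trans ss.
    by apply; apply: map_f.
  rewrite -setI_eq0 (_ : [set i] :&: _ = set0).
    rewrite eqxx /inversions big_set1 big1 ?scale1r.
      by congr ext_mon; apply/setP=> j; rewrite !inE.
    by move=> j; rewrite inE => /lt_i; rewrite ltnNge => /negbTE le_ij;
       rewrite ltn_neqAle le_ij andbF.
  apply/setP=> j; rewrite !inE; apply/negP=> /andP[/eqP-> /lt_i].
  by rewrite ltnn.
move=> sXE; have eqX : [set:: enum X] = X by apply/setP=> i; rewrite inE mem_enum.
rewrite prodE ?eqX //.
have sub_en : subseq (map val (enum X)) (map val (enum 'I_n)).
  by apply: map_subseq; rewrite {1}/enum_mem -enumT /= filter_subseq.
rewrite (subseq_sorted ltn_trans sub_en) // val_enum_ord iota_ltn_sorted //.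
Qed.

(* d e_X = \sum_j (-1)^j e_(X \ i_j) for X = {i_1 < i_2 < ...}; the position j
   of i in X is the number of elements of X that are at most i. *)
Definition ext_bd (X : {set 'I_n}) : exterior K E :=
  \sum_(i in X) (-1) ^+ #|[set k in X | (k <= i)%N]| *: ext_mon K E (X :\ i).

Definition ext_aug (f : exterior K E) : K^o :=
  f (exist (fun X : {set 'I_n} => X \subset E) set0 (sub0set E)).

Fact ext_aug_linear : linear ext_aug.
Proof. by move=> a f g; rewrite /ext_aug !ffunE. Qed.
HB.instance Definition _ := GRing.isLinear.Build K _ _ _ ext_aug ext_aug_linear.

Fact ext_augM f g : ext_aug (f * g) = (ext_aug f : K) * ext_aug g.
Proof.
rewrite /ext_aug ffunE; set z := exist _ _ _.
rewrite (sum_single (i := z)).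
  rewrite (sum_single (i := z)); last first.
    move=> Y neY; rewrite /ext_coef set0U (_ : (_ == _) = false) ?andbF ?mul0r //.
    by apply: contraNF neY => /eqP eqY; rewrite -val_eqE /= eqY.
  by rewrite /ext_coef /= set0U eqxx -setI_eq0 set0I eqxx inversions0l mul1r.
move=> X neX; rewrite big1 // => Y _; rewrite /ext_coef.
rewrite (_ : (_ == _) = false) ?andbF ?mul0r //.
by apply: contraNF neX; rewrite setU_eq0 -val_eqE => /andP[].
Qed.

Fact ext_aug_mon (X : {set 'I_n}) : ext_aug (ext_mon K E X) = (X == set0)%:R.
Proof. by rewrite /ext_aug ffunE eq_sym. Qed.

Fact ext_aug_bd (X : {set 'I_n}) : (1 < #|X|)%N -> ext_aug (ext_bd X) = 0.
Proof.
move=> X1; rewrite linear_sum big1 // => i iX; rewrite linearZ /= ext_aug_mon.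
rewrite -cards_eq0; move: X1; rewrite (cardsD1 i X) iX add1n ltnS lt0n.
by move/negbTE->; rewrite scaler0.
Qed.

End ExteriorMonomials.

(* The quotient of a vector space by a subspace. *)
Section QuotientSpace.
Import VectorInternalTheory.
Variables (K : fieldType) (V : vectType K) (U : {vspace V}).

Definition quotv : Type := Quotient.quot (pred_of_vspace U : zmodClosed V).

HB.instance Definition _ := GRing.Zmodule.on quotv.
HB.instance Definition _ := EqQuotient.on quotv.

Definition quotv_class (v : V) : quotv := \pi v.

Fact quotv_eq u v : (quotv_class u == quotv_class v) = (u - v \in U).
Proof. by rewrite -[LHS]/(\pi_quotv u == \pi v) piE. Qed.

Fact quotv_repr q : quotv_class (repr q) = q.
Proof. exact: reprK. Qed.

Fact quotv_ind (P : quotv -> Prop) : (forall v, P (quotv_class v)) -> forall q, P q.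
Proof. by move=> Pv q; rewrite -[q]quotv_repr. Qed.

Fact quotv_classD u v : quotv_class (u + v) = quotv_class u + quotv_class v.
Proof. exact: Quotient.pi_add. Qed.

Definition quotv_scale (a : K) (q : quotv) := quotv_class (a *: repr q).

Fact quotv_scaleE a v : quotv_scale a (quotv_class v) = quotv_class (a *: v).
Proof.
apply/eqP; rewrite quotv_eq -scalerBr memvZ // -quotv_eq quotv_repr //.
Qed.

Fact quotv_scaleA a b q :
  quotv_scale a (quotv_scale b q) = quotv_scale (a * b) q.
Proof. by elim/quotv_ind: q => v; rewrite !quotv_scaleE scalerA. Qed.

Fact quotv_scale1 : left_id 1 quotv_scale.
Proof. by elim/quotv_ind=> v; rewrite quotv_scaleE scale1r. Qed.

Fact quotv_scaleDr : right_distributive quotv_scale +%R.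
Proof.
move=> a; elim/quotv_ind=> u; elim/quotv_ind=> v.
by rewrite -quotv_classD !quotv_scaleE scalerDr quotv_classD.
Qed.

Fact quotv_scaleDl q : {morph quotv_scale^~ q : a b / a + b}.
Proof.
move=> a b; elim/quotv_ind: q => v.
by rewrite !quotv_scaleE scalerDl quotv_classD.
Qed.

HB.instance Definition _ := GRing.Zmodule_isLmodule.Build K quotv
  quotv_scaleA quotv_scale1 quotv_scaleDr quotv_scaleDl.

Fact quotv_class_linear : linear quotv_class.
Proof. by move=> a u v; rewrite quotv_classD -quotv_scaleE. Qed.
HB.instance Definition _ :=
  GRing.isLinear.Build K V quotv _ quotv_class quotv_class_linear.

Fact quotv_eq0 v : (quotv_class v == 0) = (v \in U).
Proof. by rewrite -(linear0 quotv_class) quotv_eq subr0. Qed.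

Let to_compl (q : quotv) : subvs_of (U^C)%VS :=
  vsproj _ (daddv_pi (U^C)%VS U (repr q)).

Fact quotv_vect : Vector.axiom (\dim (U^C)%VS) quotv.
Proof.
have capCU : (U^C :&: U)%VS = 0%VS by rewrite capvC capv_compl.
have addCU : (U^C + U)%VS = fullv by rewrite addvC addv_complf.
have toE v : to_compl (quotv_class v) = vsproj _ (daddv_pi (U^C)%VS U v).
  apply/eqP; rewrite /to_compl -subr_eq0 -!linearB /=.
  have: repr (quotv_class v) - v \in U by rewrite -quotv_eq quotv_repr.
  move=> Uv; rewrite (_ : daddv_pi _ _ _ = 0) ?linear0 //.
  have capUC : (U :&: U^C)%VS = 0%VS by rewrite capvC.
  have: repr (quotv_class v) - v \in (U^C + U)%VS by rewrite addCU memvf.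
  move=> /(daddv_pi_add capCU); rewrite (daddv_pi_id capUC) //.
  by rewrite -[RHS]add0r => /addIr.
have lin_to : linear to_compl.
  move=> a; elim/quotv_ind=> u; elim/quotv_ind=> v.
  by rewrite -linearP !toE !linearP.
have toK : cancel to_compl (quotv_class \o vsval).
  elim/quotv_ind=> v; rewrite toE /= vsprojK ?memv_pi //.
  apply/eqP; rewrite quotv_eq.
  have: v \in (U^C + U)%VS by rewrite addCU memvf.
  move=> /(daddv_pi_add capCU) eqv; set w := daddv_pi _ _ _.
  have -> : w - v = - daddv_pi U (U^C)%VS v.
    by rewrite -[in LHS]eqv opprD addrA subrr sub0r.
  by rewrite memvN memv_pi.
have Kto : cancel (quotv_class \o vsval) to_compl.
  by move=> w; rewrite /= toE (daddv_pi_id capCU) ?subvsP // vsvalK.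
exists (v2r \o to_compl).
  move=> a u v.
  transitivity (v2r (a *: to_compl u + to_compl v)).
    exact: (congr1 (fun w => v2r w) (lin_to a u v)).
  rewrite linearD linearZ //.
exists ((quotv_class \o vsval) \o r2v).
  by move=> q; rewrite /= v2rK; apply: toK.
by move=> r; rewrite -[RHS]r2vK;
   exact: (congr1 (fun w => v2r w) (Kto _)).
Qed.

HB.instance Definition _ := Lmodule_hasFinDim.Build K quotv quotv_vect.

End QuotientSpace.

Section Ideals.
Variables (K : fieldType) (A : falgType K).
Local Open Scope vspace_scope.

(* The two-sided ideal generated by G. *)
Definition gen_ideal (G : seq A) : {vspace A} := fullv * <<G>> * fullv.

Record proper_ideal := ProperIdeal {
  ideal_vspace :> {vspace A};
  ideal_mull : (fullv * ideal_vspace <= ideal_vspace)%VS;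
  ideal_mulr : (ideal_vspace * fullv <= ideal_vspace)%VS;
  ideal_proper : 1%R \notin ideal_vspace
}.

Lemma gen_ideal_mull G : (fullv * gen_ideal G <= gen_ideal G)%VS.
Proof. by rewrite /gen_ideal !prodvA !prodvSl // subvf. Qed.

Lemma gen_ideal_mulr G : (gen_ideal G * fullv <= gen_ideal G)%VS.
Proof. by rewrite /gen_ideal -!prodvA !prodvSr // subvf. Qed.

Lemma gen_ideal_mem G g : g \in G -> g \in gen_ideal G.
Proof.
move=> gG; rewrite -[g]mul1r -[(1 * g)%R]mulr1.
by rewrite !memv_mul ?memvf ?memv_span.
Qed.

Lemma gen_ideal_min G (J : {vspace A}) :
  (fullv * J <= J)%VS -> (J * fullv <= J)%VS -> {subset G <= J} ->
  (gen_ideal G <= J)%VS.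
Proof.
move=> lJ rJ /span_subvP sGJ; apply: subv_trans rJ; apply: prodvSl.
by apply: subv_trans lJ; apply: prodvSr.
Qed.
End Ideals.

Section QuotientAlgebra.
Variables (K : fieldType) (A : falgType K) (I : proper_ideal A).

(* The quotient of an algebra by a two-sided ideal. *)
Definition quota : Type := quotv I.

HB.instance Definition _ := Vector.on quota.

Definition quota_class (a : A) : quota := quotv_class I a.
HB.instance Definition _ := GRing.Linear.copy quota_class (quotv_class I).

Definition quota_mul (p q : quota) : quota :=
  quota_class (repr (p : quotv I) * repr (q : quotv I)).

Fact quota_mulE a b :
  quota_mul (quota_class a) (quota_class b) = quota_class (a * b).
Proof.
apply/eqP; rewrite quotv_eq; set a' := repr _; set b' := repr _.
have Ia : a' - a \in (I : {vspace A}) by rewrite -quotv_eq quotv_repr.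
have Ib : b' - b \in (I : {vspace A}) by rewrite -quotv_eq quotv_repr.
have -> : a' * b' - a * b = (a' - a) * b' + a * (b' - b).
  by rewrite mulrBl mulrBr addrA subrK.
apply: memvD.
  by apply: (subvP (ideal_mulr I)); rewrite memv_mul ?memvf.
by apply: (subvP (ideal_mull I)); rewrite memv_mul ?memvf.
Qed.

Fact quota_ind (P : quota -> Prop) : (forall a, P (quota_class a)) -> forall q, P q.
Proof. exact: quotv_ind. Qed.

Fact quota_mulA : associative quota_mul.
Proof.
elim/quota_ind=> a; elim/quota_ind=> b; elim/quota_ind=> c.
by rewrite !quota_mulE mulrA.
Qed.

Fact quota_mul1 : left_id (quota_class 1) quota_mul.
Proof. by elim/quota_ind=> a; rewrite quota_mulE mul1r. Qed.

Fact quota_mulr1 : right_id (quota_class 1) quota_mul.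
Proof. by elim/quota_ind=> a; rewrite quota_mulE mulr1. Qed.

Fact quota_mulDl : left_distributive quota_mul +%R.
Proof.
elim/quota_ind=> a; elim/quota_ind=> b; elim/quota_ind=> c.
by rewrite -linearD !quota_mulE mulrDl linearD.
Qed.

Fact quota_mulDr : right_distributive quota_mul +%R.
Proof.
elim/quota_ind=> a; elim/quota_ind=> b; elim/quota_ind=> c.
by rewrite -linearD !quota_mulE mulrDr linearD.
Qed.

Fact quota_one_neq0 : quota_class 1 != 0.
Proof. by rewrite quotv_eq0 ideal_proper. Qed.

HB.instance Definition _ := GRing.Zmodule_isNzRing.Build quota
  quota_mulA quota_mul1 quota_mulr1 quota_mulDl quota_mulDr quota_one_neq0.

Lemma quota_classM a b : quota_class (a * b) = quota_class a * quota_class b.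
Proof. by rewrite -quota_mulE. Qed.

Fact quota_classZ (k : K) a : quota_class (k *: a) = k *: quota_class a.
Proof. exact: linearZ. Qed.

Fact quota_scaleAl (k : K) (p q : quota) : k *: (p * q) = (k *: p) * q.
Proof.
elim/quota_ind: p => a; elim/quota_ind: q => b.
by rewrite -quota_classZ -!quota_classM -quota_classZ scalerAl.
Qed.
HB.instance Definition _ := GRing.Lmodule_isLalgebra.Build K quota quota_scaleAl.

Fact quota_scaleAr (k : K) (p q : quota) : k *: (p * q) = p * (k *: q).
Proof.
elim/quota_ind: p => a; elim/quota_ind: q => b.
by rewrite -quota_classZ -!quota_classM -quota_classZ scalerAr.
Qed.
HB.instance Definition _ := GRing.Lalgebra_isAlgebra.Build K quota quota_scaleAr.
HB.instance Definition _ := Algebra_isFalgebra.Build K quota.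

End QuotientAlgebra.

Section OrlikSolomon.
Variables (K : fieldType) (n : nat) (N : matroid n).
Let E := ground N.

Definition os_gens : seq (exterior K E) :=
  [seq ext_bd K E C | C : {set 'I_n} <- enum (circuits N) & (1 < #|C|)%N]
    ++ [seq ext_mon K E C | C : {set 'I_n} <- enum (circuits N)].

Fact circuit_neq0 : set0 \notin circuits N.
Proof.
by rewrite inE; apply/negP=> /minsetp; rewrite inE /indep sub0set rk0 cards0 eqxx.
Qed.

Fact os_ideal_proper : 1 \notin gen_ideal os_gens.
Proof.
suff sub : (gen_ideal os_gens <= lker (linfun (@ext_aug K n E)))%VS.
  apply/negP=> /(subvP sub); rewrite memv_ker lfunE /= ext_aug_mon eqxx.
  by rewrite oner_eq0.
apply: gen_ideal_min.
- apply/prodvP=> f g _; rewrite !memv_ker !lfunE /= ext_augM => /eqP->.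
  by rewrite mulr0.
- apply/prodvP=> f g + _; rewrite !memv_ker !lfunE /= ext_augM => /eqP->.
  by rewrite mul0r.
move=> f; rewrite mem_cat memv_ker lfunE /= => /orP[] /mapP[C].
  by rewrite mem_filter => /andP[C1 _] ->; rewrite ext_aug_bd.
rewrite mem_enum => cC ->; rewrite ext_aug_mon.
by case: (C =P set0) cC => [->|_ _]; rewrite ?(negbTE circuit_neq0) ?eqxx.
Qed.

Definition os_ideal : proper_ideal (exterior K E) :=
  ProperIdeal (gen_ideal_mull _) (gen_ideal_mulr _) os_ideal_proper.

Definition OS : falgType K := quota os_ideal.

Definition os_mon (X : {set 'I_n}) : OS := quota_class os_ideal (ext_mon K E X).

End OrlikSolomon.

Section BiasAlgebra.
Variables (K : fieldType) (n : nat) (M : matroid n) (CL : {set {set 'I_n}}).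

(* The ideal of OS(N) generated by e_p, N the extended lift. *)
Definition bias_ideal : {vspace OS K (extended_lift M CL)} :=
  gen_ideal [:: os_mon K (extended_lift M CL) [set ord_max]].

(* Only the vector space structure of the bias algebra is needed. *)
Definition bias_algebra : vectType K := quotv bias_ideal.

Definition bias_mon (X : {set 'I_n}) : bias_algebra :=
  quotv_class bias_ideal (os_mon K (extended_lift M CL) (up X)).

End BiasAlgebra.

Fixpoint seq_inversions n (s : seq 'I_n) : nat :=
  if s is a :: s' then (count (fun b : 'I_n => (b < a)%N) s' + seq_inversions s')%N
  else 0.

(* The sign of the permutation sorting s. *)
Definition sort_sign (K : fieldType) n (s : seq 'I_n) : K :=
  (-1) ^+ seq_inversions s.

Section SequenceMaps.
Variables (K : fieldType) (n : nat) (M : matroid n) (CL : {set {set 'I_n}}).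
Variable x : 'I_n.

Local Notation Zdel := (bias_algebra K (delete M x) (lc_delete CL x)).
Local Notation Z := (bias_algebra K M CL).
Local Notation Zcon := (bias_algebra K (contract M x) (lc_contract M CL x)).

Definition is_inclusion_map (i : 'Hom(Zdel, Z)) : Prop :=
  forall I : {set 'I_n}, indep (delete M x) I ->
    i (bias_mon K (delete M x) (lc_delete CL x) I) = bias_mon K M CL I.

(* The sign for which e_(x |: J) is e_x e_J ([front]) or e_J e_x (otherwise), for
   x not in J.  Removing x from e_I without this sign does not respect the
   relations unless x is the least or the greatest element: for the uniform
   matroid of rank 2 on {1,2,3} and x = 2, the relation
   e_2 e_3 - e_1 e_3 + e_1 e_2 would be sent to e_3 + e_1, whereas e_1 = e_3 in
   the Orlik-Solomon algebra of the contraction.  The sign is 1 if x is the least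
   element and [front] holds, or x is the greatest element and [front] fails. *)
Definition move_sign (front : bool) (J : {set 'I_n}) : K :=
  sort_sign K (if front then x :: enum J else rcons (enum J) x).

(* The sign of the monomial obtained by replacing y by x in place in e_I. *)
Definition replace_sign (y : 'I_n) (I : {set 'I_n}) : K :=
  sort_sign K [seq (if z == y then x else z) | z <- enum I].

(* If x and y both lie in I and [set x; y] is in CL, then e_I = 0 and
   e_(I \ x) = 0, so the second rule only concerns x not in I. *)
Definition is_projection_map (front : bool) (p : 'Hom(Z, Zcon)) : Prop :=
  let e := bias_mon K M CL in
  let e' := bias_mon K (contract M x) (lc_contract M CL x) in
  forall I : {set 'I_n},
    [/\ x \in I -> p (e I) = move_sign front (I :\ x) *: e' (I :\ x),
        forall y, x \notin I -> y \in I -> [set x; y] \in CL ->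
          p (e I) = (replace_sign y I * move_sign front (I :\ y)) *: e' (I :\ y)
      & x \notin I -> (forall y, y \in I -> [set x; y] \notin CL) ->
          p (e I) = 0].

End SequenceMaps.

Definition split_exact (K : fieldType) (U V W : vectType K)
    (i : 'Hom(U, V)) (p : 'Hom(V, W)) : Prop :=
  [/\ lker i = 0%VS, limg i = lker p, limg p = fullv
    & exists s : 'Hom(W, V), (p \o s)%VF = \1%VF].

(* Main.v *)
From HB Require Import structures.
From Stdlib Require ClassicalEpsilon.
Require Import Defs.
From mathcomp Require Import all_boot all_order all_algebra all_field ring zify.

Set Implicit Arguments.
Unset Strict Implicit.
Unset Printing Implicit Defensive.

(* Write J(M, CL) for the span, in the exterior algebra on the ground set of M, of
   the monomials e_D with D dependent and of the boundaries of the e_D such that D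
   contains a circuit of size at least 2 in CL.  The bias algebra is the quotient by
   J(M, CL): modulo e_p, the circuits C + p of the extended lift N give e_C = 0, and
   the circuits of N \ p that are not in CL give only dependent monomials.

   The map p_x comes from the residue along the class P of elements parallel to x
   in N: a monomial meeting P in a single element loses that element, and all other
   monomials go to 0.  This sends the relations of N to those of N / x, and N / x is
   the extended lift of M / x.  When P = {x}, exactness in the middle is the formula
   e_x bd(f) = - f - bd(e_x f) applied to the relations of M / x.

   For the injectivity of i_x, an element a lies in J(M, CL) if and only if e_p a is
   a relation of N, which reduces the claim to the Orlik-Solomon ideals of N and
   N \ x.  There one argues by induction on the degree, treating separately the
   components of a spanning a given flat. *)

(** * Matroids and linear classes *)

(** [extended_lift] is a choice made by epsilon, so nothing is known about it until some lift has
    been exhibited. The lift matroid of biased-graph theory provides one, and the modular-pair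
    condition on [CL] is what makes its rank function submodular.

    No monomial basis of any of these algebras is constructed. The homotopy formula for left
    multiplication by [e_y] takes its place, and this shapes the proof of injectivity. To exploit
    the formula, [bd] must preserve relations. J(M, CL) is in general not stable under [bd]: a
    circuit outside [CL] contributes its monomial but need not contribute its boundary. The
    Orlik-Solomon ideal of the loopless matroid N is stable, hence the detour through [e_p a]. The
    formula also needs a single [y] that makes all monomials of [e_y a] dependent, which is possible
    once all monomials of [a] span the same flat. *)

Section MatroidTheory.
Variables (n : nat) (M : matroid n).
Implicit Types (A B C D I X : {set 'I_n}) (x y : 'I_n) (CL : {set {set 'I_n}}).

Lemma rkU1 y A : rk M (y |: A) <= (rk M A).+1.
Proof.
rewrite (leq_trans (rk_le M _ _)) // -add1n leq_add2r.
by rewrite -(cards1 y) rk_card.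
Qed.

(** Submodularity for [A] and [D]: their intersection contains [B] and so already has the full rank
    of [D]. *)
Lemma rkU_span A B D : B \subset A -> B \subset D -> rk M B = rk M D ->
  rk M (A :|: D) = rk M A.
Proof.
move=> BA BD rBD; apply/eqP; rewrite eqn_leq andbC rk_mono ?subsetUl //=.
rewrite -(leq_add2r (rk M D)) (leq_trans _ (rk_submod M A D)) //.
by rewrite leq_add2l -rBD rk_mono // subsetI BA.
Qed.

Lemma rk_span B A : (forall y, y \in A -> rk M (y |: B) <= rk M B) ->
  rk M (B :|: A) = rk M B.
Proof.
move: {2}#|A| (erefl #|A|) => k; elim: k A => [|k IHk] A.
  by move/cards0_eq=> ->; rewrite setU0.
move=> cA AB; have /card_gt0P[y yA] : 0 < #|A| by rewrite cA.
have IH : rk M (B :|: A :\ y) = rk M B.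
  apply: IHk => [|z /setD1P[_ /AB //]].
  by move: cA; rewrite (cardsD1 y) yA => -[].
have -> : B :|: A = (B :|: A :\ y) :|: (y |: B).
  apply/setP=> z; rewrite !inE; case: (z =P y) => [->|_]; rewrite ?yA ?orbT //=.
  by case: (z \in B); rewrite ?orbF.
rewrite -IH; apply: (@rkU_span _ B); rewrite ?subsetUl ?subsetUr //.
by apply/eqP; rewrite eqn_leq AB // rk_mono // subsetUr.
Qed.

Lemma cl_eq A B : A \subset B -> rk M A = rk M B -> cl M A = cl M B.
Proof.
move=> sAB rAB; apply/setP=> z; rewrite !inE; congr (_ && _).
have -> : rk M (z |: B) = rk M (z |: A).
  rewrite -(@rkU_span (z |: A) A B) ?subsetUr // -setUA.
  by congr (rk M (_ |: _)); apply/esym/setUidPr.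
by rewrite rAB.
Qed.

Lemma indep_subset A B : A \subset B -> indep M B -> indep M A.
Proof.
move=> sAB /andP[BE /eqP rB]; rewrite /indep (subset_trans sAB) //=.
rewrite eqn_leq rk_card /= -(leq_add2r #|B :\: A|).
rewrite -{1}(setIidPr sAB) cardsID -rB -{1}(setID B A) (setIidPr sAB).
by rewrite (leq_trans (rk_le M _ _)) // leq_add2l rk_card.
Qed.

Lemma indep0 : indep M set0.
Proof. by rewrite /indep sub0set rk0 cards0. Qed.

Lemma indepNE A : A \subset ground M -> ~~ indep M A = (rk M A < #|A|).
Proof. by move=> AE; rewrite /indep AE /= neq_ltn [X in _ || X]ltnNge rk_card orbF. Qed.

Lemma circuitP C : reflect
  [/\ C \subset ground M, ~~ indep M C & forall i, i \in C -> indep M (C :\ i)]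
  (C \in circuits M).
Proof.
rewrite inE; apply: (iffP minsetP) => [[/andP[CE dC] minC]|[CE dC minC]].
  split=> // i iC; apply: contraT => dCi.
  have := minC (C :\ i); rewrite inE dCi (subset_trans (subD1set _ _)) //= subD1set.
  by move=> /(_ isT isT)/setP/(_ i); rewrite !inE eqxx iC.
split=> [|B /andP[BE dB] BC]; first exact/andP.
apply/eqP; apply: contraNT dB => nBC.
have /properP[_ [i iC niB]] : B \proper C by rewrite properEneq nBC.
by apply: indep_subset (minC _ iC); rewrite subsetD1 BC.
Qed.

Lemma circuit_ground C : C \in circuits M -> C \subset ground M.
Proof. by case/circuitP. Qed.

Lemma circuit_dep C : C \in circuits M -> ~~ indep M C.
Proof. by case/circuitP. Qed.

Lemma circuit_proper C A : C \in circuits M -> A \proper C -> indep M A.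
Proof.
case/circuitP=> _ _ minC /properP[AC [i iC niA]].
by apply: indep_subset (minC _ iC); rewrite subsetD1 AC.
Qed.

Lemma circuit_min C D : C \in circuits M -> D \subset C -> ~~ indep M D -> D = C.
Proof.
move=> cC DC dD; apply/eqP; apply: contraNT dD => nDC.
by apply: (circuit_proper cC); rewrite properEneq nDC.
Qed.

Lemma dep_circuit A : A \subset ground M -> ~~ indep M A ->
  exists2 C, C \in circuits M & C \subset A.
Proof.
move=> AE dA.
case: (@minset_exists _ [pred B : {set 'I_n} | (B \subset ground M) && ~~ indep M B] A).
  by rewrite inE AE.
by move=> C mC CA; exists C; rewrite // inE.
Qed.

Lemma circuit_rk C : C \in circuits M -> (rk M C).+1 = #|C|.
Proof.
case/circuitP=> CE dC minC; move: (dC); rewrite indepNE // => lt.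
have /card_gt0P[i iC] : 0 < #|C| by apply: leq_ltn_trans lt.
apply/eqP; rewrite eqn_leq lt /= (cardsD1 i C) iC add1n ltnS.
by have /andP[_ /eqP <-] := minC i iC; rewrite rk_mono // subD1set.
Qed.

(** The intersection is a proper subset of [C], hence independent, so the nullities of the two
    circuits add up in the union. This is circuit elimination in rank form. *)
Lemma circuitsU_rk C D : C \in circuits M -> D \in circuits M -> C != D ->
  (rk M (C :|: D)).+2 <= #|C :|: D|.
Proof.
move=> cC cD nCD; have iCD : indep M (C :&: D).
  apply: (circuit_proper cC); rewrite properEneq subsetIl andbT.
  apply: contra nCD => /eqP/setIidPl CD; apply/eqP.
  by apply: (circuit_min cD CD); apply: circuit_dep.
have := rk_submod M C D; have := cardsUI C D.
have := circuit_rk cC; have := circuit_rk cD; have /andP[_ /eqP] := iCD; lia.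
Qed.

(** One element added to an independent set raises the nullity by at most one, which leaves no room
    for two circuits. *)
Lemma circuit_uniq B g C D : indep M B -> C \in circuits M -> D \in circuits M ->
  C \subset g |: B -> D \subset g |: B -> C = D.
Proof.
move=> iB cC cD CB DB; apply/eqP; apply: contraT => nCD.
have := circuitsU_rk cC cD nCD.
have /indep_subset/(_ iB)/andP[_ /eqP r] : (C :|: D) :\ g \subset B.
  by rewrite subDset subUset CB.
have := rk_mono M (subD1set (C :|: D) g); rewrite r (cardsD1 g (C :|: D)).
by case: (g \in _) => /=; lia.
Qed.

Lemma basis_exists I X : indep M I -> I \subset X ->
  exists B, [/\ I \subset B, B \subset X, indep M B & rk M B = rk M X].
Proof.
move=> iI IX; pose P B := [&& I \subset B, B \subset X & indep M B].
have PI : P I by rewrite /P subxx IX.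
case: (arg_maxnP (fun B => #|B|) PI) => B /and3P[IB BX iB] maxB.
exists B; split=> //; rewrite -(setUidPr BX); apply/esym/rk_span => y yX.
rewrite leqNgt; apply/negP=> lt; have /andP[BE /eqP rB] := iB.
have nyB : y \notin B.
  apply: contraTN lt => yB; rewrite -leqNgt rk_mono // subUset sub1set yB /=.
  exact: subxx.
have yE : y \in ground M.
  apply: contraLR lt => nyE; rewrite -leqNgt -(rk_ground M (y |: B)) rk_mono //.
  apply/subsetP=> z /setIP[/setU1P[->|//]]; by rewrite (negbTE nyE).
have := maxB (y |: B); rewrite /P (subset_trans IB (subsetUr _ _)).
rewrite subUset sub1set yX BX /indep subUset sub1set yE BE /= cardsU1 nyB.
rewrite add1n ltnn eqn_leq -rB lt andbT rkU1 => /(_ isT).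
by [].
Qed.

(** Fundamental circuits of one basis decide for all circuits, by induction on the number of
    elements of [C] outside the basis. A basis exchange lowers this number, and a fundamental
    circuit of the new basis is either an old one or lies in the union of a modular pair of old
    ones. *)
Lemma linear_class_basis (CL : {set {set 'I_n}}) X B C :
  linear_class M CL -> B \subset X -> indep M B -> rk M B = rk M X ->
  (forall D, D \in circuits M -> D \subset X -> #|D :\: B| = 1 -> D \in CL) ->
  C \in circuits M -> C \subset X -> C \in CL.
Proof.
move=> [sCL lCL] BX iB rBX fund cC CX.
move: #|C :\: B|.-1 (leqSpred #|C :\: B|) => k.
elim: k B BX iB rBX fund => [|k IHk] B BX iB rBX fund leC.
  apply: fund => //; apply/eqP; rewrite eqn_leq leC /= card_gt0.
  apply: contra (circuit_dep cC); rewrite setD_eq0 => CB.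
  exact: indep_subset iB.
have [le1|gt1] := leqP #|C :\: B| 1.
  apply: fund => //; apply/eqP; rewrite eqn_leq le1 /= card_gt0.
  apply: contra (circuit_dep cC); rewrite setD_eq0 => CB.
  exact: indep_subset iB.
have /andP[BE /eqP crB] := iB.
have fundamental e : e \in ground M -> e \in X -> e \notin B ->
    exists C1, [/\ C1 \in circuits M, C1 \subset e |: B, e \in C1 & C1 \in CL].
  move=> eE eX eB; have [||C1 cC1 C1B] := @dep_circuit (e |: B).
  - by rewrite subUset sub1set eE.
  - rewrite indepNE ?subUset ?sub1set ?eE // cardsU1 eB ltnS -crB rBX.
    by rewrite rk_mono // subUset sub1set eX.
  have eC1 : e \in C1.
    apply: contraLR (circuit_dep cC1) => eC1; rewrite negbK.
    by apply: indep_subset iB; rewrite -(setU1K eB) subsetD1 C1B.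
  exists C1; split=> //; apply: fund => //.
    by apply: subset_trans C1B _; rewrite subUset sub1set eX.
  rewrite (_ : C1 :\: B = [set e]) ?cards1 //; apply/setP=> z; rewrite !inE.
  apply/andP/eqP=> [[zB /(subsetP C1B)]|->]; last by rewrite eB.
  by rewrite !inE (negbTE zB) orbF => /eqP.
have /card_gt0P[e /setDP[eC eB]] : 0 < #|C :\: B| by apply: ltnW.
have eE := subsetP (circuit_ground cC) e eC; have eX := subsetP CX e eC.
have [C1 [cC1 C1B eC1 CLC1]] := fundamental e eE eX eB.
(* [C1] has one element outside [B] and [C] at least two. Since [f] is not in [C], exchanging it for
   [e] brings the basis closer to [C]. *)
have /subsetPn[f fC1 fC] : ~~ (C1 \subset C).
  apply: contraL gt1 => C1C; rewrite -leqNgt.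
  rewrite -(circuit_min cC C1C (circuit_dep cC1)) -(cards1 e) subset_leq_card //.
  by rewrite subDset setUC.
have nfe : f != e by apply: contraNneq fC => ->.
have fB : f \in B by have := subsetP C1B f fC1; rewrite !inE (negbTE nfe).
pose B' := e |: (B :\ f).
have cB' : #|B'| = #|B|.
  by rewrite cardsU1 !inE (negbTE eB) andbF (cardsD1 f B) fB.
have B'X : B' \subset X.
  by rewrite subUset sub1set eX (subset_trans (subD1set _ _)).
have rB' : rk M B' = rk M X.
  apply/eqP; rewrite eqn_leq rk_mono //= -rBX.
  rewrite -(@rkU_span B' (C1 :\ f) C1) ?subD1set //.
  - apply: rk_mono; apply/subsetP=> z zB; rewrite !inE zB.
    by case: (z =P f) => [->|_]; rewrite ?fC1 ?orbT.
  - apply/subsetP=> z /setD1P[nzf /(subsetP C1B)]; rewrite !inE nzf.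
    by [].
  have /circuitP[_ _ /(_ f fC1)/andP[_ /eqP->]] := cC1.
  by have := circuit_rk cC1; rewrite (cardsD1 f C1) fC1 => -[].
have iB' : indep M B'.
  rewrite /indep rB' -rBX crB cB' eqxx andbT subUset sub1set eE.
  by rewrite (subset_trans (subD1set _ _)).
apply: (IHk B') => //; last first.
  rewrite -ltnS (leq_trans _ leC) // (cardsD1 e (C :\: B)) inE eC eB /=.
  rewrite ltnS subset_leq_card //; apply/subsetP=> z; rewrite !inE negb_or negb_and.
  case: (z =P f) => [->|_] /=; first by rewrite (negbTE fC) andbF.
  by case/andP=> /andP[-> ->] ->.
move=> D cD DX /eqP/cards1P[g DB'].
have gD : g \in D by have := set11 g; rewrite -DB' => /setDP[].
have gB' : g \notin B' by have := set11 g; rewrite -DB' => /setDP[].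
have DsubB' : D \subset g |: B'.
  by rewrite setUC -subDset DB'.
have Dfund h : D :\: B \subset [set h] -> D \in CL.
  move=> DB; apply: fund => //; apply/eqP; rewrite eqn_leq.
  rewrite -{1}(cards1 h) subset_leq_card //= card_gt0.
  apply: contra (circuit_dep cD); rewrite setD_eq0 => DsB; exact: indep_subset iB.
have [eD|eD] := boolP (e \in D); last first.
  apply: (Dfund g); apply/subsetP=> z /setDP[zD zB].
  move: (subsetP DsubB' z zD); rewrite !inE (negbTE zB) andbF orbF.
  by case/orP=> // /eqP ze; rewrite ze (negbTE eD) in zD.
have nge : g != e by apply: contraNneq gB' => ->; rewrite setU11.
have [gf|ngf] := eqVneq g f.
  apply: (Dfund e); apply/subsetP=> z /setDP[zD zB].
  move: (subsetP DsubB' z zD); rewrite !inE (negbTE zB) andbF orbF gf.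
  by case/orP=> // /eqP zf; rewrite zf fB in zB.
have gB : g \notin B by move: gB'; rewrite !inE (negbTE nge) ngf.
have gE := subsetP (circuit_ground cD) g gD; have gX := subsetP DX g gD.
have [C2 [cC2 C2B gC2 CLC2]] := fundamental g gE gX gB.
have nC12 : C1 != C2.
  apply: contraNneq nge => C12; have := subsetP C1B g; rewrite C12 gC2 !inE.
  by rewrite (negbTE gB) orbF => /(_ isT).
have rC12 := circuitsU_rk cC1 cC2 nC12.
(* [C1] and [C2] form a modular pair: removing [e] and [g] from their union leaves a subset of [B],
   so its nullity is exactly two. *)
apply: (lCL C1 C2) => //.
  apply/eqP; rewrite eqn_leq rk_submod andbT.
  have iI : indep M (C1 :&: C2).
    apply: (circuit_proper cC1); rewrite properE subsetIl; apply/subsetPn.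
    exists e; rewrite // inE eC1 /=; apply: contra eB => /(subsetP C2B).
    by rewrite !inE eq_sym (negbTE nge).
  have /indep_subset/(_ iB)/andP[_ /eqP r] : (C1 :|: C2) :\ e :\ g \subset B.
    apply/subsetP=> z; rewrite !inE =>
      /and3P[nzg nze] /orP[/(subsetP C1B)|/(subsetP C2B)];
    by rewrite !inE ?(negbTE nzg) ?(negbTE nze).
  have leU : #|C1 :|: C2| <= (rk M (C1 :|: C2)).+2.
    rewrite (cardsD1 e) (cardsD1 g (_ :\ e)) !inE eC1 gC2 nge orbT /= !add1n !ltnS.
    by rewrite -r rk_mono // (subset_trans (subD1set _ _)) // subD1set.
  have := cardsUI C1 C2; have := circuit_rk cC1; have := circuit_rk cC2.
  have /andP[_ /eqP] := iI; move: leU; clear; lia.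
(* Eliminating [f] from [C1] and [C2] leaves a circuit inside [g |: B'], which must be the
   fundamental circuit [D]. *)
have [||D' cD' D'C] := @dep_circuit ((C1 :|: C2) :\ f).
- rewrite (subset_trans (subD1set _ _)) // subUset.
  by rewrite (circuit_ground cC1) (circuit_ground cC2).
- rewrite indepNE.
    rewrite (leq_ltn_trans (rk_mono M (subD1set _ _))) //.
    by move: rC12; rewrite (cardsD1 f (_ :|: _)) inE fC1.
  rewrite (subset_trans (subD1set _ _)) // subUset.
  by rewrite (circuit_ground cC1) (circuit_ground cC2).
rewrite (_ : D = D'); first exact: subset_trans D'C (subD1set _ _).
apply: (@circuit_uniq B' g) => //; apply: subset_trans D'C _.
apply/subsetP=> z; rewrite !inE => /andP[nzf] /orP[/(subsetP C1B)|/(subsetP C2B)];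
  by rewrite !inE nzf => /orP[->|->]; rewrite ?orbT.
Qed.

(** The term comes from biased graphs: the balanced sets are those that keep their rank in the lift
    without [p]. *)
Definition balanced (CL : {set {set 'I_n}}) A :=
  [forall C in circuits M, (C \subset A) ==> (C \in CL)].

Lemma balancedP CL A : reflect
  (forall C, C \in circuits M -> C \subset A -> C \in CL) (balanced CL A).
Proof.
apply: (iffP forall_inP) => bA C cC; first by move=> CA; apply: (implyP (bA C cC)).
by apply/implyP; apply: bA.
Qed.

Lemma balanced_subset CL A B : A \subset B -> balanced CL B -> balanced CL A.
Proof.
by move=> AB /balancedP bB; apply/balancedP=> C cC CA; apply: bB (subset_trans CA AB).
Qed.

(** Bases of [A] and of [B] that extend a common basis of the intersection have, by modularity, a
    basis of [A :|: B] as their union. Each fundamental circuit of that basis lies in [A] or in [B],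
    so [linear_class_basis] applies. *)
Lemma balancedU CL A B : linear_class M CL -> balanced CL A -> balanced CL B ->
  rk M (A :|: B) + rk M (A :&: B) = rk M A + rk M B -> balanced CL (A :|: B).
Proof.
move=> lCL /balancedP bA /balancedP bB modAB.
have [I [_ IAB iI rI]] := basis_exists indep0 (sub0set (A :&: B)).
have [IA [IIA IAA iIA rIA]] := basis_exists iI (subset_trans IAB (subsetIl _ _)).
have [IB [IIB IBB iIB rIB]] := basis_exists iI (subset_trans IAB (subsetIr _ _)).
pose U := IA :|: IB.
have rU : rk M U = rk M (A :|: B).
  rewrite -(@rkU_span U IA A) ?subsetUl // -(@rkU_span (U :|: A) IB B) //.
    by congr (rk M _); rewrite -setUA; apply/setUidPr/setUSS.
  by rewrite (subset_trans (subsetUr IA IB)) // subsetUl.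
have iU : indep M U.
  have [IAE /eqP cIA] := andP iIA; have [IBE /eqP cIB] := andP iIB.
  have [_ /eqP cI] := andP iI.
  rewrite /indep subUset IAE IBE eqn_leq rk_card /= rU.
  have : #|I| <= #|IA :&: IB| by rewrite subset_leq_card // subsetI IIA.
  have := cardsUI IA IB; rewrite -/U; move: modAB rI rIA rIB cIA cIB cI.
  clear; move: #|U|; clear; lia.
apply/balancedP=> C; apply: (@linear_class_basis CL (A :|: B) U) => //.
  exact: setUSS.
move=> D cD DAB /eqP/cards1P[e DU].
have [eD eU] : e \in D /\ e \notin U by have := set11 e; rewrite -DU => /setDP[].
have eE := subsetP (circuit_ground cD) e eD.
have DeU : D \subset e |: U by rewrite setUC -subDset DU.
(* [D] is the only circuit inside [e |: U], so it is the one found inside [e |: J]. *)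
have key (J X : {set 'I_n}) : J \subset U -> J \subset X -> indep M J ->
  rk M J = rk M X -> e \in X ->
    D \subset X.
  move=> JU JX iJ rJ eX; have [JE /eqP cJ] := andP iJ.
  have eJE : e |: J \subset ground M by rewrite subUset sub1set eE.
  have [//||D1 cD1 D1J] := @dep_circuit (e |: J).
    rewrite indepNE // cardsU1 (contra (subsetP JU e)) //= add1n ltnS -cJ rJ.
    by rewrite rk_mono // subUset sub1set eX.
  rewrite (circuit_uniq iU cD cD1 DeU) ?(subset_trans D1J) ?setUS //.
  by rewrite subUset sub1set eX.
case/setUP: (subsetP DAB e eD) => [eA|eB].
  by apply: bA => //; apply: (key IA); rewrite // subsetUl.
by apply: bB => //; apply: (key IB); rewrite // subsetUr.
Qed.

End MatroidTheory.

(** * Elementary lifts *)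

Section Up.
Variable n : nat.
Implicit Types (A B C D : {set 'I_n}) (x y : 'I_n) (S : {set 'I_n.+1}).
Local Notation p := (@ord_max n).
Local Notation u := (lift (@ord_max n)).

Lemma mem_up A x : (u x \in up A) = (x \in A).
Proof. exact: (mem_imset _ _ (@lift_inj _ p)). Qed.

Lemma p_notin_up A : p \notin up A.
Proof. by apply/imsetP=> -[x _ /eqP]; rewrite (negbTE (neq_lift _ _)). Qed.

Lemma p_lift x : (p == u x) = false.
Proof. exact/negbTE/neq_lift. Qed.

Lemma lift_p x : (u x == p) = false.
Proof. by rewrite eq_sym p_lift. Qed.

Lemma up_ind (P : 'I_n.+1 -> Prop) : P p -> (forall x, P (u x)) -> forall z, P z.
Proof. by move=> Pp Pu z; case: (unliftP p z) => [x ->|->]. Qed.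

Definition down S : {set 'I_n} := [set x | u x \in S].

Lemma upK A : down (up A) = A.
Proof. by apply/setP=> x; rewrite inE mem_up. Qed.

Lemma downpK A : down (p |: up A) = A.
Proof. by apply/setP=> x; rewrite inE !inE lift_p mem_up. Qed.

Lemma downK S : up (down S) = S :\ p.
Proof.
apply/setP=> z; elim/up_ind: z => [|x];
  first by rewrite !inE eqxx (negbTE (p_notin_up _)).
by rewrite mem_up !inE lift_p.
Qed.

Lemma downK_out S : p \notin S -> up (down S) = S.
Proof. by move=> pS; rewrite downK; apply/setDidPl;
  rewrite disjoint_sym disjoints1. Qed.

Lemma downK_in S : p \in S -> p |: up (down S) = S.
Proof. by move=> pS; rewrite downK setD1K. Qed.

Lemma set_up_ind (P : {set 'I_n.+1} -> Prop) :
  (forall A, P (up A)) -> (forall A, P (p |: up A)) -> forall S, P S.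
Proof.
move=> Pu Pp S; have [pS|pS] := boolP (p \in S).
  by rewrite -(downK_in pS).
by rewrite -(downK_out pS).
Qed.

Lemma card_up A : #|up A| = #|A|.
Proof. exact: (card_imset _ (@lift_inj _ p)). Qed.

Lemma card_pup A : #|p |: up A| = #|A|.+1.
Proof. by rewrite cardsU1 p_notin_up card_up. Qed.

Lemma upS A B : (up A \subset up B) = (A \subset B).
Proof.
apply/subsetP/subsetP=> sAB x; first by rewrite -mem_up => /sAB; rewrite mem_up.
by case/imsetP=> y yA ->; rewrite mem_up sAB.
Qed.

Lemma pupS A B : (p |: up A \subset p |: up B) = (A \subset B).
Proof.
rewrite -upS; apply/idP/idP=> [/subsetP sAB|]; last exact: setUS.
apply/subsetP=> z zA; have := sAB z; rewrite !inE zA orbT => /(_ isT)/orP[/eqP zp|//].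
by rewrite zp (negbTE (p_notin_up A)) in zA.
Qed.

Lemma up_pupS A B : (up A \subset p |: up B) = (A \subset B).
Proof.
by rewrite -pupS subUset sub1set setU11.
Qed.

Lemma upU1 x A : up (x |: A) = u x |: up A.
Proof. by rewrite /up imsetU imset_set1. Qed.

Lemma up1 x : up [set x] = [set u x].
Proof. by rewrite /up imset_set1. Qed.

Lemma upD1 A x : up (A :\ x) = up A :\ u x.
Proof.
apply/setP; elim/up_ind=> [|z]; rewrite ?(negbTE (p_notin_up _)) !inE.
  by rewrite (negbTE (p_notin_up _)) andbF.
by rewrite !mem_up !inE (inj_eq (@lift_inj _ p)).
Qed.

Lemma up0 : up (set0 : {set 'I_n}) = set0.
Proof. exact: imset0. Qed.

End Up.

Section Lift.
Variable n : nat.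
Implicit Types (M : matroid n) (N : matroid n.+1) (A B C D : {set 'I_n}) (x y : 'I_n).
Implicit Types (CL : {set {set 'I_n}}).
Local Notation p := (@ord_max n).
Local Notation u := (lift (@ord_max n)).

(* The matroid N, on the ground set of M and p, has N / p = M, and the circuits of
   M that stay dependent in N \ p are those in CL. *)
Definition is_lift M CL N : Prop :=
  [/\ ground N = p |: up (ground M),
      forall A, rk N (p |: up A) = (rk M A).+1
    & forall C, C \in circuits M -> (C \in CL) = ~~ indep N (up C)].

Section ElementaryLift.
Variables (M : matroid n) (CL : {set {set 'I_n}}).
Hypothesis lCL : linear_class M CL.

(** The rank function of the lift matroid of a biased graph, with [p] as the extra point. *)
Let lrk (S : {set 'I_n.+1}) :=
  (rk M (down S) + ((p \in S) || ~~ balanced M CL (down S)))%N.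

Let downI (S T : {set 'I_n.+1}) : down (S :&: T) = down S :&: down T :> {set 'I_n}.
Proof. by apply/setP=> z; rewrite !inE. Qed.

Let downU (S T : {set 'I_n.+1}) : down (S :|: T) = down S :|: down T :> {set 'I_n}.
Proof. by apply/setP=> z; rewrite !inE. Qed.

Let lrk_ground S : lrk (S :&: (p |: up (ground M))) = lrk S.
Proof.
rewrite /lrk downI downpK rk_ground !inE eqxx andbT; congr (_ + (_ || ~~ _))%N.
apply/balancedP/balancedP=> bS C cC CS; apply: bS => //.
  by rewrite subsetI CS circuit_ground.
exact: subset_trans CS (subsetIl _ _).
Qed.

Let lrk_card S : lrk S <= #|S|.
Proof.
elim/set_up_ind: S => A; rewrite /lrk ?upK ?downpK ?card_up ?card_pup.
  rewrite (negbTE (p_notin_up A)) /=.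
  have [|/balancedP nb] := boolP (balanced M CL A); rewrite ?addn0 ?rk_card //=.
  rewrite addn1 -rk_ground (leq_trans _ (subset_leq_card (subsetIl A (ground M)))) //.
  rewrite -indepNE ?subsetIr //; apply/negP=> iA; apply: nb => C cC CA.
  have := circuit_dep cC; rewrite (indep_subset _ iA) //.
  by rewrite subsetI CA circuit_ground.
by rewrite setU11 addn1 ltnS rk_card.
Qed.

Let lrk_mono (S T : {set 'I_n.+1}) : S \subset T -> lrk S <= lrk T.
Proof.
move=> ST; have dST : down S \subset down T.
  by apply/subsetP=> z; rewrite !inE; apply: subsetP.
apply: leq_add; first exact: rk_mono.
case: (boolP (p \in S)) => [/(subsetP ST)-> //|_] /=.
case: (boolP (balanced M CL (down S))) => // nb.
by rewrite (contra (balanced_subset dST)) ?orbT.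
Qed.

Let lrk_submod (S T : {set 'I_n.+1}) : lrk (S :|: T) + lrk (S :&: T) <= lrk S + lrk T.
Proof.
rewrite /lrk downI downU !inE.
have := rk_submod M (down S) (down T).
have := @balancedU _ _ CL (down S) (down T) lCL.
have := @balanced_subset _ M CL _ _ (subsetIl (down S) (down T)).
have := @balanced_subset _ M CL _ _ (subsetIr (down S) (down T)).
case: (balanced M CL (_ :&: _)) => /=; last first.
  case: (balanced M CL (down T)) => [/(_ isT)//|_].
  case: (balanced M CL (down S)) => [/(_ isT)//|_ _]; rewrite !orbT.
  by case: (_ || _) => /=; clear; lia.
move=> _ _; rewrite orbF.
case: (p \in S); case: (p \in T) => /=;
  case: (balanced M CL (down S)); case: (balanced M CL (down T)) => /=;
  case: (balanced M CL (_ :|: _)) => //= h le; try (move: le; clear; lia).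
(* The case left: [S] and [T] are balanced and avoid [p], but their union is unbalanced. By
   [balancedU] the pair is then not modular, and this strictness pays for the extra unit of rank. *)
rewrite addn1 addn0 addSn !addn0 ltn_neqAle le andbT.
by apply/eqP=> /(h isT isT).
Qed.

Definition elementary_lift : matroid n.+1 :=
  Matroid lrk_ground lrk_card lrk_mono lrk_submod.

Lemma elementary_liftP : is_lift M CL elementary_lift.
Proof.
split=> // [A|C cC]; first by rewrite /= /lrk downpK setU11 addn1.
rewrite indepNE; last by rewrite /= up_pupS circuit_ground.
rewrite /= /lrk upK (negbTE (p_notin_up C)) card_up -(circuit_rk cC) ltnS /=.
apply/idP/idP=> [CCL|].
  suff -> : balanced M CL C by rewrite addn0.
  apply/balancedP=> D cD DC; by rewrite (circuit_min cC DC) ?circuit_dep.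
case: balancedP => [bC _|_]; first exact: bC.
by rewrite addn1 ltnn.
Qed.

End ElementaryLift.

(** * Lifts of a matroid and extensions of its dual *)

Lemma dual_rkE m (M : matroid m) (A : {set 'I_m}) : A \subset ground M ->
  rk (dual M) A + rk M (ground M) = #|A| + rk M (ground M :\: A).
Proof.
move=> AE; rewrite /= (setIidPl AE) subnK // -{1}(setID (ground M) A).
by rewrite (leq_trans (rk_le M _ _)) // leq_add2r (setIidPr AE) rk_card.
Qed.

Lemma dual_circuit M C : C \in circuits M -> hyperplane (dual M) (ground M :\: C).
Proof.
move=> cC; have [CE _ minC] := circuitP _ _ cC; set E := ground M; set H := E :\: C.
have HE : H \subset E := subsetDl _ _.
have EH : E :\: H = C by rewrite setDDr setDv set0U; apply/setIidPr.
have rH := dual_rkE HE; rewrite -/E EH in rH.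
have rE := dual_rkE (subxx (ground M)); rewrite setDv rk0 addn0 -/E in rE.
have cH : #|H| + #|C| = #|E| by rewrite -(cardsID C E) (setIidPr CE) addnC.
have rC := circuit_rk cC.
apply/and3P; split=> //; last first.
  by apply/eqP; move: rH rE cH rC; rewrite -[ground (dual M)]/E; clear; lia.
rewrite eqEsubset andbC; apply/andP; split.
  apply/subsetP=> z zH; rewrite inE (subsetP HE) //=.
  by rewrite (setUidPr _) ?sub1set.
apply/subsetP=> z; rewrite inE => /andP[zE /eqP rzH]; apply: contraT => zH.
have zC : z \in C by rewrite inE negb_and (subsetP (subxx _) z zE) orbF negbK in zH.
have zHE : z |: H \subset E by rewrite subUset sub1set zE.
have EzH : E :\: (z |: H) = C :\ z by rewrite setUC -setDDl EH.
have := dual_rkE zHE; rewrite -/E rzH cardsU1 zH EzH.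
have /andP[_ /eqP->] := minC z zC; have := cardsD1 z C; rewrite zC.
by move: rH rC; clear; lia.
Qed.

Lemma dual_hyperplane M H : hyperplane (dual M) H -> ground M :\: H \in circuits M.
Proof.
case/and3P=> HE /eqP clH /eqP rkH; rewrite /= in HE; set E := ground M in HE *.
have rH := dual_rkE HE; have rE := dual_rkE (subxx (ground M)).
rewrite -/E setDv rk0 addn0 in rH rE.
have cH : #|H| + #|E :\: H| = #|E| by rewrite -(cardsID H E) (setIidPr HE).
have rC : (rk M (E :\: H)).+1 = #|E :\: H|.
  by move: rH rE cH rkH; clear; rewrite -/E; lia.
have CE : E :\: H \subset ground M := subsetDl _ _.
apply/circuitP; split=> [//||z zC]; first by rewrite indepNE // -rC.
have /setDP[zE zH] := zC.
have zHE : z |: H \subset ground M by rewrite subUset sub1set zE.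
have rzH : rk (dual M) (z |: H) != rk (dual M) H.
  by apply: contra zH => rzH; rewrite -clH inE zE.
have EzH : E :\: (z |: H) = (E :\: H) :\ z by rewrite setUC -setDDl.
have := dual_rkE zHE; rewrite -/E cardsU1 zH EzH => rz.
rewrite /indep (subset_trans (subD1set _ _)) //=.
have cz := cardsD1 z (E :\: H); rewrite zC in cz.
have := rk_card M ((E :\: H) :\ z); have := rkU1 M z ((E :\: H) :\ z).
rewrite setD1K // eqn_leq => le1 ->; move: le1 rzH rz rH rC cz; clear.
by move: (rk (dual M) H) (rk _ (z |: H)) => a b; rewrite /= ?add1n; lia.
Qed.

Lemma lift_groundD M N A : ground N = p |: up (ground M) ->
  ground N :\: up A = p |: up (ground M :\: A).
Proof.
move=> ->; apply/setP; elim/up_ind=> [|z]; rewrite !inE ?eqxx ?p_notin_up //.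
by rewrite lift_p !mem_up !inE.
Qed.

Lemma lift_groundDp M N A : ground N = p |: up (ground M) ->
  ground N :\: (p |: up A) = up (ground M :\: A).
Proof.
move=> ->; apply/setP; elim/up_ind=> [|z];
  rewrite !inE ?eqxx ?(negbTE (p_notin_up _)) //.
by rewrite lift_p !mem_up !inE.
Qed.

Lemma lift_groundI M N A : ground N = p |: up (ground M) ->
  up A :&: ground N = up (A :&: ground M).
Proof.
move=> ->; apply/setP; elim/up_ind=> [|z];
  rewrite !inE ?eqxx ?(negbTE (p_notin_up _)) //.
by rewrite lift_p !mem_up !inE.
Qed.

Lemma dual_lift M CL N : is_lift M CL N -> is_lift_extension M CL (dual N).
Proof.
case=> gN rN cN; have rG : rk N (ground N) = (rk M (ground M)).+1 by rewrite gN rN.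
have r_up A : rk (dual N) (up A) = rk (dual M) A.
  by rewrite /= (lift_groundI _ gN) (lift_groundD _ gN) card_up rN rG addnS subSS.
have upE A : A \subset ground M -> p |: up A \subset ground N.
  by move=> AE; rewrite gN pupS.
have r_pup A : A \subset ground M ->
    rk (dual N) (p |: up A) + (rk M (ground M)).+1 = #|A|.+1 + rk N (up (ground M :\:
      A)).
  by move=> AE; rewrite -rG (dual_rkE (upE A AE)) card_pup (lift_groundDp _ gN).
have in_cl A : (p \in cl (dual N) (up A)) = (rk (dual N) (p |:
  up A) == rk (dual N) (up A)).
  by rewrite inE [ground _]gN setU11.
split.
  split=> //; rewrite in_cl r_up -[ground (dual M)]/(ground M); apply/eqP.
  have := r_pup _ (subxx _); have := dual_rkE (subxx (ground M)).
  by rewrite setDv up0 !rk0; lia.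
move=> H hH; have cC := dual_hyperplane hH; have /and3P[HE _ /eqP] := hH.
rewrite -[ground (dual M)]/(ground M) => rkH; rewrite /= in HE.
rewrite in_cl cN //.
rewrite indepNE; last by rewrite gN up_pupS subsetDl.
rewrite card_up r_up.
have := r_pup _ HE; have := dual_rkE HE; have := dual_rkE (subxx (ground M)).
rewrite setDv rk0; have := circuit_rk cC.
have := rk_card N (up (ground M :\: H)); have := rkU1 N p (up (ground M :\: H)).
rewrite rN card_up; lia.
Qed.

Lemma lift_of_extension M CL Ns : is_lift_extension M CL Ns -> is_lift M CL (dual Ns).
Proof.
case=> -[]; rewrite -[ground (dual M)]/(ground M) => gN rN pcl hN.
have /setIdP[_ /eqP rpE] := pcl.
(* Here [p] is not a coloop of [Ns]. Dually it is not a loop of the lift, which produces the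
   successor in [(rk M A).+1]. *)
have rG : rk Ns (ground Ns) = rk (dual M) (ground M) by rewrite gN rpE rN.
have rE := dual_rkE (subxx (ground M)); rewrite setDv rk0 addn0 in rE.
split=> // [A|C cC].
  rewrite -[LHS]rk_ground -[in RHS]rk_ground; set B := A :&: ground M.
  have BE : B \subset ground M := subsetIr _ _.
  have -> : (p |: up A) :&: ground (dual Ns) = p |: up B.
    rewrite /= gN; apply/setP; elim/up_ind=> [|z]; rewrite !inE ?eqxx //.
    by rewrite !lift_p !mem_up !inE.
  have pBG : p |: up B \subset ground Ns by rewrite gN pupS.
  have := dual_rkE pBG; rewrite rG card_pup (lift_groundDp _ gN) rN.
  have := dual_rkE (subsetDl (ground M) B); rewrite setDDr setDv set0U (setIidPr BE).
  by have := cardsID B (ground M); rewrite (setIidPr BE); lia.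
have hC := dual_circuit cC; have CE := circuit_ground cC.
rewrite -{1}(setIidPr CE) -{1}(set0U (_ :&: _)) -(setDv (ground M)) -setDDr -hN //.
have upC : up C \subset ground Ns by rewrite gN up_pupS.
rewrite indepNE // inE gN setU11 andTb.
have := dual_rkE upC; rewrite rG (lift_groundD _ gN) !card_up rN.
have /and3P[_ _ /eqP] := hC; rewrite -[ground (dual M)]/(ground M).
have := rkU1 Ns p (up (ground M :\: C)).
have : rk Ns (p |: up (ground M :\: C)) <= rk Ns (ground Ns).
  by rewrite rk_mono // gN pupS subsetDl.
have := rk_mono Ns (subsetUr [set p] (up (ground M :\: C))).
rewrite rG rN; clear; move: (rk Ns (p |: up _)); move: (rk (dual M) (_ :\: C)).
move: (rk (dual M) _) (rk (dual Ns) _) #|C| => a b c d e h1 h2 h3 h4 h5.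
by apply/eqP/idP; lia.
Qed.

(** Epsilon meets its specification as soon as some extension does, and the dual of any lift is one.
    The extension that it chooses then dualizes back to a lift. *)
Lemma extended_liftP M CL : (exists N, is_lift M CL N) ->
  is_lift M CL (extended_lift M CL).
Proof.
case=> N /dual_lift lN; apply: lift_of_extension.
by apply: ClassicalEpsilon.epsilon_spec; exists (dual N).
Qed.

(** * Minors of a matroid and of its lift *)

Lemma nonloop_ground m (M : matroid m) (x : 'I_m) : rk M [set x] = 1%N ->
  x \in ground M.
Proof.
move=> rx; apply: contraT => xE; move: rx;
  rewrite -rk_ground (_ : _ :&: _ = set0) ?rk0 //.
by apply/eqP; rewrite setI_eq0 disjoints1.
Qed.

Lemma indep_delete m (M : matroid m) (x : 'I_m) (I : {set 'I_m}) :
  indep (delete M x) I = indep M I && (x \notin I).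
Proof.
rewrite /indep /= subsetD1 -!andbA; case: (boolP (x \in I)) => [_|xI];
  rewrite ?andbF //=.
by rewrite andbT; congr (_ && (rk M _ == _)); apply/setDidPl;
  rewrite disjoint_sym disjoints1.
Qed.

Lemma indep_contract m (M : matroid m) (x : 'I_m) (I : {set 'I_m}) :
  rk M [set x] = 1%N ->
  indep (contract M x) I = (x \notin I) && indep M (x |: I).
Proof.
move=> rx; have xE := nonloop_ground rx.
rewrite /indep /= subsetD1 subUset sub1set xE /= rx cardsU1 -andbA andbCA.
case: (boolP (x \in I)) => //= _; congr (_ && _).
have : 0 < rk M (x |: I) by rewrite -rx rk_mono // subsetUl.
by case: (rk M _) => // k _; rewrite subn1 add1n eqSS.
Qed.

Lemma circuits_delete m (M : matroid m) (x : 'I_m) (C : {set 'I_m}) :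
  (C \in circuits (delete M x)) = (C \in circuits M) && (x \notin C).
Proof.
apply/circuitP/andP=> [[CE dC minC]|[/circuitP[CE dC minC] xC]].
  have [CE' xC] : C \subset ground M /\ x \notin C by apply/andP; rewrite -subsetD1.
  move: dC; rewrite indep_delete xC andbT => dC; split=> //.
  apply/circuitP; split=> // i /minC; by rewrite indep_delete => /andP[].
split; [by rewrite subsetD1 CE | by rewrite indep_delete (negbTE dC) |].
by move=> i /minC iC; rewrite indep_delete iC !inE negb_and xC orbT.
Qed.

Lemma lift_delete M CL N x : is_lift M CL N ->
  is_lift (delete M x) (lc_delete CL x) (delete N (u x)).
Proof.
case=> gN rN cN; split=> [|A|C].
- rewrite /= gN; apply/setP; elim/up_ind=> [|z]; rewrite !inE ?eqxx ?p_lift //.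
  by rewrite lift_p !mem_up !inE (inj_eq (@lift_inj _ p)).
- rewrite /= -rN upD1; congr (rk N _); apply/setP=> z; rewrite !inE.
  by case: (z =P p) => [->|//]; rewrite p_lift.
rewrite circuits_delete => /andP[cC xC].
by rewrite indep_delete mem_up inE xC !andbT cN.
Qed.

Section LiftTheory.
Variables (M : matroid n) (CL : {set {set 'I_n}}) (N : matroid n.+1).
Hypothesis lN : is_lift M CL N.

Let gN : ground N = p |: up (ground M). Proof. by case: lN. Qed.
Let rN A : rk N (p |: up A) = (rk M A).+1. Proof. by case: lN. Qed.

Lemma lift_rk_up A : rk M A <= rk N (up A).
Proof. by rewrite -ltnS -rN rkU1. Qed.

Lemma lift_indep_p A : indep N (p |: up A) = indep M A.
Proof. by rewrite /indep rN card_pup eqSS gN pupS. Qed.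

Lemma lift_indep A : indep M A -> indep N (up A).
Proof. by rewrite -lift_indep_p; apply: indep_subset (subsetUr _ _). Qed.

(** [up C] is independent in [N] and already has the rank of [p |: up C], so [p] lies in its closure
    and adding [p] to [up A] costs nothing. *)
Lemma lift_rk_unbalanced C A : C \in circuits M -> C \notin CL -> C \subset A ->
  rk N (up A) = (rk M A).+1.
Proof.
move=> cC CCL CA; have [_ _ /(_ C cC) cN] := lN.
have iC : indep N (up C) by rewrite -[indep _ _]negbK -cN.
rewrite -rN -(@rkU_span _ N (up A) (up C) (p |: up C)) ?upS ?subsetUr //.
  by rewrite setUCA (setUidPl (_ : up C \subset up A)) ?upS.
by have /andP[_ /eqP->] := iC; rewrite rN card_up circuit_rk.
Qed.

(** [A] has nullity one in [M]. A circuit of [A] outside [CL] would add one unit of rank in [N] and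
    so make [up A] independent. *)
Lemma lift_dep A : A \subset ground M -> ~~ indep N (up A) -> (rk M A).+1 = #|A| ->
  exists C, [/\ C \in circuits M, C \in CL & C \subset A].
Proof.
move=> AE dA rA; have [||C cC CA] := @dep_circuit _ M A => //.
  by apply: contra dA; apply: lift_indep.
exists C; split=> //; apply: contraR dA => CCL.
by rewrite /indep gN up_pupS AE card_up (lift_rk_unbalanced cC CCL CA) rA eqxx.
Qed.

(** The two parts of [lc_contract] match the two origins of a circuit [C] of the contraction:
    [x |: C] is a circuit of [M] if [x] is in the closure of [C], and otherwise [C] itself is
    one. *)
Lemma lift_contract x : CL \subset circuits M -> rk M [set x] = 1%N ->
  is_lift (contract M x) (lc_contract M CL x) (contract N (u x)).
Proof.
move=> sCL rx; have rux : rk N [set u x] = 1%N.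
  apply/eqP; rewrite eqn_leq -{1}(cards1 (u x)) rk_card /=.
  by rewrite -rx -up1 lift_rk_up.
have rcon A : rk (contract M x) A = (rk M (x |: A)).-1 by rewrite /= rx subn1.
split=> [|A|C cC].
- rewrite /= gN; apply/setP; elim/up_ind=> [|z]; rewrite !inE ?eqxx ?p_lift //.
  by rewrite lift_p !mem_up !inE (inj_eq (@lift_inj _ p)).
- rewrite rcon /= rux setUCA -upU1 rN subn1 /= prednK //.
  by rewrite -rx rk_mono // subsetUl.
have := circuit_ground cC; rewrite /= subsetD1 => /andP[CE xC].
have xE := nonloop_ground rx.
rewrite indep_contract // mem_up xC -upU1 /=.
have xCE : x |: C \subset ground M by rewrite subUset sub1set xE.
have := circuit_rk cC; rewrite rcon prednK; last first.
  by rewrite -rx rk_mono // subsetUl.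
move=> rxC.
have [_ _ /(_ (x |: C)) cN1] := lN; have [_ _ /(_ C) cN2] := lN.
have dxC : ~~ indep M (x |: C) by rewrite indepNE // cardsU1 xC rxC.
have min_xC i : i \in C -> indep M (x |: (C :\ i)).
  by have /circuitP[_ _ minC] := cC => /minC; rewrite indep_contract // => /andP[].
have [xcl|xcl] := boolP (x \in cl M C).
  have iC : indep M C by move: xcl; rewrite inE xE /indep CE -rxC /= eq_sym.
  have cxC : x |: C \in circuits M.
    apply/circuitP; split=> // i /setU1P[->|iC']; first by rewrite setU1K.
    suff -> : (x |: C) :\ i = x |: (C :\ i) by apply: min_xC.
    apply/setP=> z; rewrite !inE; case: (z =P x) => // ->.
    by rewrite andbT (contraNneq _ xC) // => ->.
  rewrite -cN1 // in_setU [X in _ || X]in_set xcl andbF orbF;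
    apply/imsetP/idP=> [[D /setIdP[DCL xD]]|xCCL].
    by move->; rewrite setD1K.
  by exists (x |: C); rewrite ?setU1K // inE xCCL setU11.
have cC' : C \in circuits M.
  apply/circuitP; split=> // [|i /min_xC]; last exact: indep_subset (subsetUr _ _).
  rewrite indepNE //; move: xcl; rewrite inE xE /= rxC => neC.
  by rewrite ltn_neqAle rk_card andbT eq_sym.
rewrite in_setU [X in _ || X]in_set xcl andbT orb_idl; last first.
  case/imsetP=> D /setIdP[DCL xD] eC;
    have /circuitP[_ _ /(_ x xD)] := subsetP sCL D DCL.
  by rewrite -eC (negbTE (circuit_dep cC')).
apply/idP/idP=> [CCL|]; first by move: CCL; rewrite cN2 //; apply: contra;
  apply: indep_subset; rewrite upS subsetUr.
apply: contraR => CCL; rewrite /indep gN up_pupS xCE card_up cardsU1 xC.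
by rewrite (lift_rk_unbalanced cC' CCL (subsetUr _ _)) rxC eqxx.
Qed.

End LiftTheory.

End Lift.

Import GRing.Theory.
Local Open Scope ring_scope.

(** * Linear maps on the exterior algebra *)

Section LinearExtension.
Variables (K : fieldType) (n : nat) (E : {set 'I_n}).
Implicit Types (X Y C D : {set 'I_n}) (x y i : 'I_n).

Lemma ext_mon_out X : ~~ (X \subset E) -> ext_mon K E X = 0.
Proof.
move=> nXE; apply/ffunP=> Z; rewrite !ffunE (_ : (_ == _) = false) //.
by apply: contraNF nXE => /eqP <-; exact: (valP Z).
Qed.

Definition ext_lin (V : lmodType K) (g : {set 'I_n} -> V) (f : exterior K E) : V :=
  \sum_X (f X : K) *: g (val X).

Fact ext_lin_linear (V : lmodType K) (g : {set 'I_n} -> V) : linear (@ext_lin V g).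
Proof.
move=> a f h; rewrite scaler_sumr -big_split; apply: eq_bigr => X _ /=.
by rewrite !ffunE scalerDl scalerA.
Qed.
HB.instance Definition _ (V : lmodType K) (g : {set 'I_n} -> V) :=
  GRing.isLinear.Build K _ _ _ (@ext_lin V g) (ext_lin_linear g).

Lemma ext_linE (V : lmodType K) (g : {set 'I_n} -> V) X : X \subset E ->
  ext_lin g (ext_mon K E X) = g X.
Proof.
move=> XE; rewrite /ext_lin (sum_single (i := Sub X XE)) ?ffunE ?eqxx ?scale1r //.
move=> Y neY; rewrite ffunE (_ : (_ == _) = false) ?scale0r //.
by apply: contraNF neY => /eqP eqY; rewrite -val_eqE /= eqY.
Qed.

Lemma ext_ind (P : exterior K E -> Prop) :
  (forall a f h, P f -> P h -> P (a *: f + h)) -> P 0 ->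
  (forall X, X \subset E -> P (ext_mon K E X)) -> forall f, P f.
Proof.
move=> PD P0 PX f; rewrite [f]ext_sum_mon.
elim/big_rec: _ => // X g _ Pg; apply: PD => //; apply: PX; exact: (valP X).
Qed.

Lemma eq_ext_lin (V : lmodType K) (f g : {linear exterior K E -> V}) :
  (forall X, X \subset E -> f (ext_mon K E X) = g (ext_mon K E X)) -> f =1 g.
Proof.
by move=> fg; elim/ext_ind=> [a u v fu fv||X /fg //];
  rewrite ?linear0 // !linearP fu fv.
Qed.

Lemma ext_lin_sub (V : vectType K) (U : {vspace V}) (f : {linear exterior K E -> V}) :
  (forall X, X \subset E -> f (ext_mon K E X) \in U) -> forall a, f a \in U.
Proof.
move=> fU; elim/ext_ind=> [a u v fu fv||X /fU //]; rewrite ?linear0 ?mem0v //.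
by rewrite linearP memvD ?memvZ.
Qed.

(** The exponent of the sign relating [e_i e_X] to the sorted monomial. *)
Definition lo i X := #|[set k in X | (k < i)%N]|.

Lemma inversions1 y X : inversions [set y] X = lo y X.
Proof.
by rewrite /inversions big_set1 /lo -sum1dep_card big_mkcondr.
Qed.

Lemma loD1 i j X : j \in X -> lo i X = ((j < i) + lo i (X :\ j))%N.
Proof.
move=> jX; rewrite /lo (cardsD1 j) inE jX /=; congr (_ + _)%N.
by apply: eq_card => k; rewrite !inE; case: (k == j).
Qed.

Lemma loU1 i j X : j \notin X -> lo i (j |: X) = ((j < i) + lo i X)%N.
Proof. by move=> jX; rewrite (@loD1 i j) ?setU11 // setU1K. Qed.

(** Positions start at one in [ext_bd] and at zero in [lo], hence the global sign, which reappears
    as [- f] in the homotopy formula. *)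
Lemma ext_bdE X : ext_bd K E X = - \sum_(i in X) (-1) ^+ lo i X *: ext_mon K E (X :\ i).
Proof.
rewrite /ext_bd -sumrN; apply: eq_bigr => i iX; rewrite -scaleNr.
congr (_ *: _); rewrite -[RHS]mulN1r -exprS; congr (_ ^+ _);
  rewrite (cardsD1 i) inE iX leqnn /=; congr _.+1.
by apply: eq_card => k; rewrite !inE (ltn_neqAle k); case: (k \in X); rewrite ?andbF.
Qed.

Definition bd : exterior K E -> exterior K E := ext_lin (ext_bd K E).
HB.instance Definition _ := GRing.Linear.copy bd (ext_lin (ext_bd K E)).

Lemma bd_mon X : X \subset E -> bd (ext_mon K E X) = ext_bd K E X.
Proof. exact: ext_linE. Qed.

Lemma mon1_mul y X : y \in E -> X \subset E ->
  ext_mon K E [set y] * ext_mon K E X =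
  if y \in X then 0 else (-1) ^+ lo y X *: ext_mon K E (y |: X).
Proof.
move=> yE XE; rewrite [LHS]ext_mon_mul ?sub1set // disjoints1 inversions1.
by case: (y \in X).
Qed.

Lemma mon1_mul_in y X : y \in E -> y \in X -> ext_mon K E [set y] * ext_mon K E X = 0.
Proof.
move=> yE yX; case: (boolP (X \subset E)) => [XE|/ext_mon_out ->].
  by rewrite mon1_mul // yX.
by rewrite mulr0.
Qed.

Lemma monU1 y X : y \notin X -> y |: X \subset E ->
  ext_mon K E (y |: X) = (-1) ^+ lo y X *: (ext_mon K E [set y] * ext_mon K E X).
Proof.
move=> yX; rewrite subUset sub1set => /andP[yE XE].
by rewrite mon1_mul // (negbTE yX) scalerA -expr2 sqrr_sign scale1r.
Qed.

(** This is the Leibniz rule with [bd e_y = -1]. On a monomial containing [y] one term of [e_y bd f]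
    survives; on any other, all terms but the one that removes [y] cancel in pairs. *)
Lemma bd_homotopy y f : y \in E ->
  bd (ext_mon K E [set y] * f) + ext_mon K E [set y] * bd f = - f.
Proof.
move=> yE; elim/ext_ind: f => [a u v IHu IHv||X XE].
- rewrite !linearP !mulrDr !linearD /= -!scalerAr !linearZ /= addrACA -scalerDr.
  by rewrite IHu IHv.
- by rewrite mulr0 linear0 mulr0 addr0 oppr0.
rewrite bd_mon // ext_bdE mulrN mulr_sumr mon1_mul //.
have [yX|yX] := boolP (y \in X).
  rewrite linear0 add0r (bigD1 y) //= big1 => [|i /andP[iX niy]].
    rewrite addr0 -scalerAr mon1_mul ?(subset_trans (subD1set _ _)) //.
    rewrite !inE eqxx /= setD1K // scalerA (@loD1 y y X) // ltnn add0n.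
    by rewrite -expr2 sqrr_sign scale1r.
  by rewrite -scalerAr mon1_mul_in ?scaler0 // !inE yX eq_sym niy.
have yXE : y |: X \subset E by rewrite subUset sub1set yE XE.
rewrite linearZ /= bd_mon // ext_bdE scalerN -opprD; congr (- _).
rewrite big_setU1 //= setU1K // loU1 // ltnn add0n.
rewrite scalerDr scalerA -expr2 sqrr_sign scale1r -addrA scaler_sumr -big_split.
rewrite big1 ?addr0 // => i iX /=.
have niy : i != y by apply: contraNneq yX => <-.
rewrite -scalerAr mon1_mul ?(subset_trans (subD1set _ _)) //.
rewrite !inE (negbTE yX) andbF !scalerA loU1 // (@loD1 y i X) //.
have -> : (y |: X) :\ i = y |: (X :\ i).
  by apply/setP=> z; rewrite !inE; case: (z =P y) => // ->; rewrite eq_sym niy.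
rewrite -scalerDl; set b := lo i X; set c := lo y _.
have -> : (i < y)%N = ~~ (y < i)%N :> bool.
  by case: ltngtP niy => // /val_inj->; rewrite eqxx.
by rewrite !exprD; case: (y < i)%N; rewrite /= ?expr0 ?expr1;
   rewrite (_ : _ + _ = 0) ?scale0r //; ring.
Qed.

Lemma superset_ind (P : {set 'I_n} -> Prop) C D : C \subset D -> P C ->
  (forall y X, C \subset X -> y \notin X -> y |: X \subset D -> P X -> P (y |: X)) ->
    P D.
Proof.
move=> CD PC PS; move: {2}#|D :\: C| (erefl #|D :\: C|) => k.
elim: k D CD PS => [|k IHk] D CD PS.
  by move/cards0_eq/eqP; rewrite setD_eq0 => DC; rewrite (_ : D = C) //; apply/eqP;
    rewrite eqEsubset DC.
move=> cD; have /card_gt0P[y yDC] : (0 < #|D :\: C|)%N by rewrite cD.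
have /setDP[yD yC] := yDC; have CDy : C \subset D :\ y by rewrite subsetD1 CD.
rewrite -(setD1K yD); apply: (PS); rewrite ?inE ?eqxx ?setD1K //.
apply: IHk => // [z X CX zX zXD PX|].
  by apply: PS => //; apply: subset_trans zXD (subD1set _ _).
by move: cD; rewrite (cardsD1 y) yDC setDDl setUC -setDDl => -[].
Qed.

Lemma mon_ind (P : exterior K E -> Prop) : P (ext_mon K E set0) ->
  (forall y X, y \in E -> X \subset E -> y \notin X -> P (ext_mon K E X) ->
     P (ext_mon K E (y |: X))) ->
  forall X, X \subset E -> P (ext_mon K E X).
Proof.
move=> P0 PS X XE; apply: (superset_ind (P := fun Y =>
  P (ext_mon K E Y)) (sub0set X) P0) => y Y _ yY yYX; apply: PS => //.
  by apply: (subsetP XE); apply: (subsetP yYX); rewrite setU11.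
by apply: subset_trans XE; apply: subset_trans yYX; rewrite subsetUr.
Qed.

Lemma bd_mon0 : bd (ext_mon K E set0) = 0.
Proof. by rewrite bd_mon ?sub0set // /ext_bd big_set0. Qed.

Lemma bd_bd f : bd (bd f) = 0.
Proof.
elim/ext_ind: f => [a u v IHu IHv|| X XE]; rewrite ?linear0 //.
  by rewrite linearP /= linearP /= IHu IHv scaler0 addr0.
elim/mon_ind: XE => {X} [|y X yE XE yX IH]; first by rewrite bd_mon0 linear0.
rewrite monU1 ?subUset ?sub1set ?yE // !linearZ /=.
have := bd_homotopy (ext_mon K E X) yE; move/(canRL (addrK _)) => ->.
have := bd_homotopy (bd (ext_mon K E X)) yE; rewrite IH mulr0 addr0.
by rewrite linearB linearN /= => ->; rewrite opprK addNr scaler0.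
Qed.

(** The parity involution. It turns right multiplication by [e_y] into left multiplication, so that
    two-sided ideals can be recognized from one side. *)
Definition grading : exterior K E -> exterior K E :=
  ext_lin (fun X => (-1) ^+ #|X| *: ext_mon K E X).
HB.instance Definition _ := GRing.Linear.copy grading
  (ext_lin (fun X => (-1) ^+ #|X| *: ext_mon K E X)).

Lemma grading_mon X : grading (ext_mon K E X) = (-1) ^+ #|X| *: ext_mon K E X.
Proof.
case: (boolP (X \subset E)) => [XE|/ext_mon_out ->]; first exact: ext_linE.
by rewrite linear0 scaler0.
Qed.

Lemma grading_bd X : grading (ext_bd K E X) = (-1) ^+ #|X|.-1 *: ext_bd K E X.
Proof.
rewrite linear_sum scaler_sumr; apply: eq_bigr => i iX.
by rewrite linearZ /= grading_mon (cardsD1 i X) iX !scalerA mulrC.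
Qed.

Lemma mul_mon1 y f : y \in E ->
  f * ext_mon K E [set y] = ext_mon K E [set y] * grading f.
Proof.
move=> yE; elim/ext_ind: f => [a u v IHu IHv||X XE].
- by rewrite linearP mulrDl mulrDr IHv -scalerAl IHu scalerAr.
- by rewrite linear0 mul0r mulr0.
rewrite grading_mon -scalerAr mon1_mul // [LHS]ext_mon_mul ?sub1set //.
rewrite disjoint_sym disjoints1; case: (boolP (y \in X)); rewrite ?scaler0 //= => yX.
rewrite scalerA setUC; congr (_ *: _).
have -> : inversions X [set y] = #|[set k in X | (y < k)%N]|.
  by rewrite -sum1dep_card big_mkcondr; apply: eq_bigr => k _; rewrite big_set1.
rewrite -exprD -(cardsID [set k : 'I_n | (k < y)%N] X) addnAC.
have -> : X :&: [set k : 'I_n | (k < y)%N] = [set k in X | (k < y)%N].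
  by apply/setP=> z; rewrite !inE.
rewrite addnn -[RHS]signr_odd oddD odd_double addFb signr_odd; congr (_ ^+ _).
apply: eq_card => k; rewrite !inE -leqNgt; case: (boolP (k \in X)) => kX //=.
  by rewrite andbT ltn_neqAle val_eqE; case: eqP kX yX => // -> ->.
by rewrite andbF.
Qed.

Lemma two_sided (W : {vspace exterior K E}) :
  (forall y f, y \in E -> f \in W -> ext_mon K E [set y] * f \in W) ->
  (forall f, f \in W -> grading f \in W) ->
  (fullv * W <= W)%VS /\ (W * fullv <= W)%VS.
Proof.
move=> lW gW; split.
  apply/prodvP=> f g _ gWm; elim/ext_ind: f => [a u v||X XE].
  - by rewrite mulrDl -scalerAl => Wu Wv; rewrite memvD ?memvZ.
  - by rewrite mul0r mem0v.
  elim/mon_ind: XE => {X} [|y X yE XE yX IH]; first by rewrite mul1r.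
  rewrite monU1 ?subUset ?sub1set ?yE // -scalerAl -mulrA memvZ //; exact: lW.
apply/prodvP=> f g fW _; elim/ext_ind: g => [a u v||X XE].
- by rewrite mulrDr -scalerAr => Wu Wv; rewrite memvD ?memvZ.
- by rewrite mulr0 mem0v.
elim/mon_ind: XE f fW => {X} [|y X yE XE yX IH] f fW; first by rewrite mulr1.
rewrite monU1 ?subUset ?sub1set ?yE // -scalerAr mulrA memvZ // IH //.
by rewrite mul_mon1 // lW ?gW.
Qed.

End LinearExtension.

(** * Relations of the bias algebra *)

Lemma span_lin (K : fieldType) (V V' : vectType K) (f : {linear V -> V'})
  (s : seq V) (U : {vspace V'}) :
  {in s, forall v, f v \in U} -> {in <<s>>%VS, forall v, f v \in U}.
Proof.
move=> sU; have sub : (<<s>> <= linfun f @^-1: U)%VS.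
  by apply/span_subvP=> v vs; rewrite -memv_preim lfunE; apply: sU.
by move=> v /(subvP sub); rewrite -memv_preim lfunE.
Qed.

Section DependenceRelations.
Variables (K : fieldType) (n : nat) (N : matroid n).
Let E := ground N.
Local Notation e := (ext_mon K E).
Implicit Types (S : {set {set 'I_n}}) (C D X : {set 'I_n}) (y : 'I_n).

(** The bound on [#|C|] discards loops, whose boundary is a unit. *)
Definition covers S D :=
  (D \subset E) && [exists C in S, (C \subset D) && (1 < #|C|)%N].

Lemma coversP S D : reflect
  (D \subset E /\ exists C, [/\ C \in S, C \subset D & (1 < #|C|)%N]) (covers S D).
Proof.
apply: (iffP andP) => [[DE /existsP[C /and3P[CS CD C1]]]|[DE [C [CS CD C1]]]].
  by split=> //; exists C.
by split=> //; apply/existsP; exists C; rewrite CS CD.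
Qed.

Lemma covers_ground S D : covers S D -> D \subset E.
Proof. by case/andP. Qed.

Lemma covers_subset S C D : C \subset D -> D \subset E -> covers S C -> covers S D.
Proof.
move=> CD DE /coversP[_ [B [BS BC B1]]]; apply/coversP; split=> //.
by exists B; split=> //; apply: subset_trans CD.
Qed.

Lemma covers_dep S D : S \subset circuits N -> covers S D -> ~~ indep N D.
Proof.
move=> sS /coversP[_ [C [/(subsetP sS) cC CD _]]].
by apply: contra (circuit_dep cC); apply: indep_subset.
Qed.

(** One family for both algebras: all circuits give the Orlik-Solomon ideal, and [CL] gives the
    relations of the bias algebra. Being a plain linear span, it reduces claims to generators
    through [dep_rel_lin]. *)
Definition dep_rel S : {vspace exterior K E} :=
  <<[seq e D | D : {set 'I_n} <- enum [pred D | ~~ indep N D]] ++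
    [seq ext_bd K E D | D : {set 'I_n} <- enum (covers S)]>>.

Lemma dep_rel_mon S D : ~~ indep N D -> e D \in dep_rel S.
Proof.
move=> dD; apply: memv_span; rewrite mem_cat; apply/orP; left.
by apply/mapP; exists D; rewrite // mem_enum inE.
Qed.

Lemma dep_rel_bd S D : covers S D -> ext_bd K E D \in dep_rel S.
Proof.
move=> cD; apply: memv_span; rewrite mem_cat; apply/orP; right.
by apply/mapP; exists D; rewrite // mem_enum.
Qed.

Lemma dep_rel_lin S (V : vectType K) (f : {linear exterior K E -> V}) (U : {vspace V}) :
  (forall D, ~~ indep N D -> f (e D) \in U) ->
  (forall D, covers S D -> f (ext_bd K E D) \in U) ->
  forall a, a \in dep_rel S -> f a \in U.
Proof.
move=> fm fb; apply: span_lin => a; rewrite mem_cat => /orP[]/mapP[D].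
  by rewrite mem_enum inE => dD ->; apply: fm.
by rewrite mem_enum => cD ->; apply: fb.
Qed.

(** By the homotopy formula [e_y bd e_D] is [- e_D - bd (e_y e_D)]. The first term is a dependent
    monomial, and the second is zero or, up to sign, the boundary of the larger set [y |: D]. *)
Lemma dep_rel_mul S y a : S \subset circuits N -> y \in E ->
  a \in dep_rel S -> e [set y] * a \in dep_rel S.
Proof.
move=> sS yE aR.
suff /(_ a aR) : forall a, a \in dep_rel S -> amull (e [set y]) a \in dep_rel S.
  by rewrite lfunE.
have mulD D : ~~ indep N D -> e [set y] * e D \in dep_rel S.
  move=> dD; have [DE|/(ext_mon_out K)->] := boolP (D \subset E);
    last by rewrite mulr0 mem0v.
  rewrite mon1_mul //; case: ifP => _; rewrite ?mem0v // memvZ // dep_rel_mon //.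
  by apply: contra dD; apply: indep_subset (subsetUr _ _).
apply: dep_rel_lin => D; rewrite /= lfunE /=; first exact: mulD.
move=> cD; have DE := covers_ground cD; rewrite -bd_mon //.
move: (bd_homotopy (e D) yE) => /(canRL (addKr _))->.
rewrite memvB ?memvN ?dep_rel_mon ?(covers_dep sS) //.
  rewrite mon1_mul //; case: ifPn => yD; rewrite ?linear0 ?mem0v // linearZ memvZ //=.
  rewrite bd_mon ?dep_rel_bd ?subUset ?sub1set ?yE //.
  by apply: covers_subset cD; rewrite ?subsetUr // subUset sub1set yE.
Qed.

Lemma dep_rel_grading S a : a \in dep_rel S -> grading a \in dep_rel S.
Proof.
apply: (dep_rel_lin (f := @grading K n E)) => D dD;
  first by rewrite /= grading_mon memvZ ?dep_rel_mon.
by rewrite /= grading_bd memvZ ?dep_rel_bd.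
Qed.

(** Every dependent set grows from a circuit one element at a time. Multiplication by [e_y] carries
    the monomials along, and the homotopy formula carries the boundaries. *)
Lemma os_idealE : os_ideal K N = dep_rel (circuits N) :> {vspace exterior K E}.
Proof.
have ideal_mul y a : y \in E -> a \in (os_ideal K N : {vspace _}) ->
    e [set y] * a \in (os_ideal K N : {vspace _}).
  by move=> yE aI; apply: (subvP (ideal_mull _)); rewrite memv_mul ?memvf.
have ideal_mon D : ~~ indep N D -> e D \in (os_ideal K N : {vspace _}).
  move=> dD; have [DE|/(ext_mon_out K)->] := boolP (D \subset E); last by rewrite mem0v.
  have [C cC CD] := dep_circuit DE dD.
  apply: (superset_ind (P := fun X => e X \in (os_ideal K N : {vspace _})) CD) =>
    [|y X CX yX yXD IH].
    apply: gen_ideal_mem; rewrite mem_cat; apply/orP; right.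
    by apply/mapP; exists C; rewrite // mem_enum.
  have yXE := subset_trans yXD DE; rewrite monU1 // memvZ // ideal_mul //.
  by rewrite (subsetP yXE) ?setU11.
apply/eqP; rewrite eqEsubv; apply/andP; split.
  have [] := @two_sided _ _ _ (dep_rel (circuits N)).
  - by move=> y f yE; apply: dep_rel_mul.
  - exact: dep_rel_grading.
  move=> lR rR; apply: gen_ideal_min => // a; rewrite mem_cat => /orP[]/mapP[C].
    rewrite mem_filter mem_enum => /andP[C1 cC] ->; apply/dep_rel_bd/coversP.
    by split; [exact: circuit_ground cC | exists C].
  by rewrite mem_enum => /circuit_dep dC ->; apply: dep_rel_mon.
apply/subvP=> a; apply: (dep_rel_lin (f := @idfun (exterior K E))) => D dD /=.
  exact: ideal_mon.
have /coversP[DE [C [cC CD C1]]] := dD.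
apply: (superset_ind (P := fun X =>
  ext_bd K E X \in (os_ideal K N : {vspace _})) CD) => [|y X CX yX yXD IH].
  apply: gen_ideal_mem; rewrite mem_cat; apply/orP; left.
  by apply/mapP; exists C; rewrite // mem_filter C1 mem_enum.
have yXE := subset_trans yXD DE; have yE : y \in E by rewrite (subsetP yXE) ?setU11.
have XE : X \subset E by apply: subset_trans (subsetUr _ _) yXE.
rewrite -bd_mon // monU1 // linearZ memvZ //=.
move: (bd_homotopy (e X) yE) => /(canRL (addrK _))->.
rewrite memvB ?memvN //; last by rewrite ideal_mul // bd_mon.
by apply: ideal_mon; apply: contra (circuit_dep cC); apply: indep_subset.
Qed.

End DependenceRelations.

(** * Presentation of the bias algebra by dependence relations *)

Section Presentation.
Variables (K : fieldType) (n : nat) (M : matroid n) (CL : {set {set 'I_n}}).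
Hypothesis sCL : CL \subset circuits M.
Local Notation p := (@ord_max n).

Section LiftMaps.
Variable N : matroid n.+1.
Hypothesis lN : is_lift M CL N.
Let gN : ground N = p |: up (ground M). Proof. by case: lN. Qed.

Let drop_mon (S : {set 'I_n.+1}) :=
  if p \in S then 0 else ext_mon K (ground M) (down S).

Definition drop_p : exterior K (ground N) -> exterior K (ground M) := ext_lin drop_mon.
HB.instance Definition _ := GRing.Linear.copy drop_p (ext_lin drop_mon).

Lemma drop_up X : drop_p (ext_mon K (ground N) (up X)) = ext_mon K (ground M) X.
Proof.
have [XE|XE] := boolP (X \subset ground M).
  by rewrite [LHS]ext_linE ?gN ?up_pupS // /drop_mon (negbTE (p_notin_up X)) upK.
by rewrite !ext_mon_out ?linear0 // gN up_pupS.
Qed.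

Lemma drop_pup (S : {set 'I_n.+1}) : p \in S -> drop_p (ext_mon K (ground N) S) = 0.
Proof.
move=> pS; have [SE|/(ext_mon_out K)->] := boolP (S \subset ground N);
  rewrite ?linear0 //.
by rewrite [LHS]ext_linE // /drop_mon pS.
Qed.

Lemma lo_up i X : lo (lift p i) (up X) = lo i X.
Proof.
rewrite /lo -[RHS]card_up; apply: eq_card; elim/up_ind=> [|z].
  by rewrite !inE !(negbTE (p_notin_up _)).
by rewrite mem_up !inE mem_up -[RHS]/(_ && _); congr (_ && _); rewrite !lift_max.
Qed.

Lemma lo_p X : lo p (up X) = #|X|.
Proof.
rewrite /lo -[RHS]card_up; apply: eq_card; elim/up_ind=> [|z]; rewrite inE.
  by rewrite (negbTE (p_notin_up _)).
by rewrite lift_max ltn_ord andbT.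
Qed.

Lemma drop_bd_up X : drop_p (ext_bd K (ground N) (up X)) = ext_bd K (ground M) X.
Proof.
rewrite !ext_bdE (linearN drop_p) (linear_sum drop_p) /=; congr (- _).
rewrite big_imset /=; last by move=> i j _ _; apply: lift_inj.
by apply: eq_bigr => i _; rewrite linearZ /= lo_up -upD1 drop_up.
Qed.

Lemma drop_bd_pup X :
  drop_p (ext_bd K (ground N) (p |: up X)) = - ((-1) ^+ #|X| *: ext_mon K (ground M) X).
Proof.
rewrite ext_bdE (linearN drop_p) (linear_sum drop_p) /=; congr (- _).
rewrite big_setU1 ?p_notin_up //= big1 ?addr0 => [|i iX].
  by rewrite linearZ /= setU1K ?p_notin_up // drop_up loU1 ?p_notin_up // ltnn lo_p.
rewrite linearZ /= drop_pup ?scaler0 // !inE eqxx andbT.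
by apply: contraTneq iX => <-; apply: p_notin_up.
Qed.

(** The nullity of [X] is at least two, so [X] minus any element is still dependent and the boundary
    is a relation term by term. *)
Lemma dep_bd_dep_rel (X : {set 'I_n}) (S : {set {set 'I_n}}) :
  X \subset ground M -> ((rk M X).+1 < #|X|)%N ->
  ext_bd K (ground M) X \in dep_rel K M S.
Proof.
move=> XE rX; rewrite ext_bdE memvN memv_suml // => i iX.
rewrite memvZ // dep_rel_mon // indepNE ?(subset_trans (subD1set _ _)) //.
rewrite -ltnS (leq_ltn_trans _ (leq_trans rX _)) // ?(cardsD1 i X) ?iX //.
by rewrite ltnS rk_mono // subD1set.
Qed.

(** Setting [e_p = 0] leaves, of the boundary of [p |: up X], only [e_X] up to sign, and [X] is
    dependent because [N / p = M]. For the boundary of [up X], nullity at least two in [M] makes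
    every term a relation, while nullity one forces the circuit of [N] inside [up X] to come from
    [CL]. *)
Lemma drop_rel a : a \in dep_rel K N (circuits N) -> drop_p a \in dep_rel K M CL.
Proof.
apply: (dep_rel_lin (f := drop_p)) => S dS /=.
  elim/set_up_ind: S dS => X dS; last by rewrite drop_pup ?setU11 ?mem0v.
  by rewrite drop_up dep_rel_mon //; apply: contra dS; apply: (lift_indep lN).
have := covers_dep (subxx _) dS; case/coversP: dS => SE [C [cC CS C1]].
elim/set_up_ind: S SE CS => X SE CS dS; last first.
  by rewrite drop_bd_pup memvN memvZ // dep_rel_mon // -(lift_indep_p lN).
rewrite gN up_pupS in SE; rewrite drop_bd_up.
have dX : ~~ indep M X by apply: contra dS; apply: (lift_indep lN).
have [|rX] := ltnP (rk M X).+1 #|X|; first exact: dep_bd_dep_rel.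
apply/dep_rel_bd/coversP; split=> //.
have pC : p \notin C by apply: contra (p_notin_up X); apply: (subsetP CS).
move: cC C1 CS; rewrite -(downK_out pC) upS card_up => cA A1 AX;
  set A := down C in cA A1 AX.
have AE := subset_trans AX SE; have dA : ~~ indep M A.
  by apply: contra (circuit_dep cA); apply: (lift_indep lN).
(* Nullity is monotone, so that of [A] is at most the nullity of [X]. *)
have rA : (rk M A).+1 = #|A|.
  apply/eqP; rewrite eqn_leq -indepNE // dA /=.
  have eX : A :|: (X :\: A) = X by rewrite -[RHS](setID X A) (setIidPr AX).
  have := rk_le M A (X :\: A); rewrite eX; have := rk_card M (X :\: A).
  have := cardsID A X; rewrite (setIidPr AX); move: rX; clear.
  by move: #|X| #|A| #|_| (rk M X) (rk M A) (rk M _) => *; lia.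
have [D [cD DCL DA]] := lift_dep lN AE (circuit_dep cA) rA.
have uDA : up D = up A.
  by apply: (circuit_min cA); rewrite ?upS //; have [_ _ /(_ D cD) <-] := lN.
by exists D; split=> //; rewrite ?(subset_trans DA) // -card_up uDA card_up.
Qed.


Definition lift_up : exterior K (ground M) -> exterior K (ground N) :=
  ext_lin (fun X => ext_mon K (ground N) (up X)).
HB.instance Definition _ := GRing.Linear.copy lift_up
  (ext_lin (fun X => ext_mon K (ground N) (up X))).

Lemma lift_up_mon X : lift_up (ext_mon K (ground M) X) = ext_mon K (ground N) (up X).
Proof.
have [XE|XE] := boolP (X \subset ground M); first exact: ext_linE.
by rewrite !ext_mon_out ?linear0 // gN up_pupS.
Qed.

Lemma lift_up_bd D : lift_up (ext_bd K (ground M) D) = ext_bd K (ground N) (up D).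
Proof.
rewrite !ext_bdE (linearN lift_up) (linear_sum lift_up) /=; congr (- _).
rewrite big_imset /=; last by move=> i j _ _; apply: lift_inj.
by apply: eq_bigr => i _; rewrite linearZ /= lo_up -upD1 lift_up_mon.
Qed.

Lemma lift_covers D : covers M CL D -> covers N (circuits N) (up D).
Proof.
case/coversP=> DM [C [CCL CD C1]]; apply/coversP; split; first by rewrite gN up_pupS.
exists (up C); rewrite upS card_up; split=> //; have cC := subsetP sCL C CCL.
apply/circuitP; split; first by rewrite gN up_pupS circuit_ground.
  by have [_ _ /(_ C cC) <-] := lN.
have /circuitP[_ _ minC] := cC; elim/up_ind=> [|i];
  first by rewrite (negbTE (p_notin_up C)).
by rewrite mem_up -upD1 => /minC/(lift_indep lN).
Qed.

Lemma drop_lift_up a : drop_p (lift_up a) = a.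
Proof.
apply: (eq_ext_lin (f := drop_p \o lift_up) (g := idfun)) => X _ /=.
by rewrite lift_up_mon drop_up.
Qed.

(** With [drop_p_grading], this makes the kernel of [drop_p] a two-sided ideal. *)
Lemma drop_p_mul y a : y \in ground N -> drop_p a = 0 ->
  drop_p (ext_mon K (ground N) [set y] * a) = 0.
Proof.
move=> yN.
have key : drop_p (ext_mon K (ground N) [set y] * a) =
    if y == p then 0 else ext_mon K (ground M) (down [set y]) * drop_p a.
  elim/ext_ind: a => [c f g IHf IHg||S SN].
  - rewrite mulrDr -scalerAr !linearP /= IHf IHg; case: ifP => _.
      by rewrite scaler0 addr0.
    by rewrite mulrDr scalerAr.
  - by rewrite mulr0 linear0 mulr0 if_same.
  rewrite mon1_mul // (fun_if drop_p) linear0 linearZ /=.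
  elim/up_ind: y yN => [|y] yN.
    by rewrite eqxx drop_pup ?setU11 // scaler0 if_same.
  rewrite lift_p -up1 upK; elim/set_up_ind: S SN => S SN; last first.
    by rewrite !drop_pup ?inE ?eqxx ?orbT // scaler0 mulr0 if_same.
  have yM : y \in ground M by move: yN; rewrite [ground N]gN !inE lift_p mem_up.
  have SM : S \subset ground M by move: SN; rewrite [ground N]gN up_pupS.
  by rewrite mem_up up1 -upU1 !drop_up mon1_mul // lo_up.
by move=> a0; rewrite key a0 mulr0 if_same.
Qed.

Lemma drop_p_grading a : drop_p (grading a) = grading (drop_p a).
Proof.
apply: (eq_ext_lin (f := drop_p \o @grading _ _ _) (g := @grading _ _ _ \o drop_p)) =>
  S SN /=.
rewrite grading_mon linearZ /=; elim/set_up_ind: S SN => S _.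
  by rewrite drop_up grading_mon card_up.
by rewrite drop_pup ?setU11 // scaler0 linear0.
Qed.

End LiftMaps.

Hypothesis exN : exists N, is_lift M CL N.
Let N := extended_lift M CL.
Let lN : is_lift M CL N := extended_liftP exN.

Local Notation os_class := (quota_class (os_ideal K N)).
Local Notation to_bias := (quotv_class (bias_ideal K M CL)).

Definition bias_of : exterior K (ground M) -> bias_algebra K M CL :=
  ext_lin (bias_mon K M CL).
HB.instance Definition _ := GRing.Linear.copy bias_of (ext_lin (bias_mon K M CL)).

Lemma bias_ofE a : bias_of a = to_bias (os_class (lift_up N a)).
Proof.
apply: (eq_ext_lin (f := bias_of) (g := to_bias \o (os_class \o lift_up N))) => X XM /=.
by rewrite [LHS]ext_linE // (lift_up_mon lN).
Qed.

Lemma bias_of_mon X : bias_of (ext_mon K (ground M) X) = bias_mon K M CL X.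
Proof. by rewrite bias_ofE (lift_up_mon lN). Qed.

Let os_rel0 a : a \in dep_rel K N (circuits N) -> to_bias (os_class a) = 0.
Proof.
by rewrite -os_idealE -quotv_eq0 => /eqP a0; rewrite [os_class a]a0 linear0.
Qed.

Let p_rel0 (S : {set 'I_n.+1}) : p \in S ->
  to_bias (os_class (ext_mon K (ground N) S)) = 0.
Proof.
move=> pS; have [SN|/(ext_mon_out K)->] := boolP (S \subset ground N);
  last by rewrite !linear0.
rewrite -(setD1K pS) monU1 ?setD1K // ?inE ?eqxx // !linearZ /=.
rewrite [to_bias _](_ : _ = 0) ?scaler0 //; apply/eqP;
  rewrite quotv_eq0 [os_class _]quota_classM.
apply: (subvP (gen_ideal_mulr _)); rewrite memv_mul ?memvf //.
by apply: gen_ideal_mem; rewrite inE.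
Qed.

(** As [N / p = M], the set [p |: up X] is dependent in [N]. Modulo [e_p] its boundary reduces to
    [e_X] up to sign. *)
Lemma bias_mon_dep X : ~~ indep M X -> bias_mon K M CL X = 0.
Proof.
move=> dX; rewrite -bias_of_mon.
have [XM|/(ext_mon_out K)->] := boolP (X \subset ground M); last by rewrite linear0.
have gN : ground N = p |: up (ground M) by case: lN.
rewrite bias_ofE (lift_up_mon lN).
have dpX : ~~ indep N (p |: up X) by rewrite (lift_indep_p lN).
have [|C cC CpX] := dep_circuit _ dpX; first by rewrite gN pupS.
have [C1|] := ltnP 1 #|C|; last first.
  (* A circuit of size one gives no boundary relation. But [p] is not a loop of [N], so this loop
     lies in [up X], which is then dependent by itself. *)
  rewrite -(circuit_rk cC) ltnS leqn0 => rC; have /cards1P[z eC] : #|C| == 1%N.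
    by rewrite -(circuit_rk cC) eqSS.
  apply/os_rel0/dep_rel_mon; apply: contra (circuit_dep cC); apply: indep_subset.
  move: CpX rC; rewrite eC !sub1set !inE => /orP[/eqP->|//].
  by have [_ /(_ set0) + _] := lN; rewrite up0 setU0 => ->.
have : ext_bd K (ground N) (p |: up X) \in dep_rel K N (circuits N).
  by apply/dep_rel_bd/coversP; split; [rewrite gN pupS | exists C].
move/os_rel0; rewrite ext_bdE (linearN os_class) (linearN to_bias) => /eqP.
rewrite oppr_eq0 (linear_sum os_class) (linear_sum to_bias) /= big_setU1 ?p_notin_up
  //= big1 ?addr0 => [|i iX].
  by rewrite !linearZ /= scaler_eq0 signr_eq0 /= setU1K ?p_notin_up // => /eqP.
rewrite !linearZ /= p_rel0 ?scaler0 // !inE eqxx andbT.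
by apply: contraTneq iX => <-; apply: p_notin_up.
Qed.

Lemma bias_of_eq0 a : (bias_of a == 0) = (a \in dep_rel K M CL).
Proof.
apply/idP/idP; last first.
  move=> aR; rewrite -[_ == 0]memv0; move: a aR.
  apply: (dep_rel_lin (f := bias_of)) => D dD /=; rewrite memv0.
    by rewrite bias_of_mon bias_mon_dep.
  by rewrite bias_ofE (lift_up_bd lN); apply/eqP/os_rel0/dep_rel_bd/(lift_covers lN).
rewrite bias_ofE quotv_eq0.
move=> aI.
(* The image of the kernel of [drop_p] in the Orlik-Solomon algebra is an ideal containing [e_p]. An
   element that vanishes in the bias algebra therefore lies in that kernel up to relations of [N],
   and [drop_rel] applies to the difference. *)
have sub : (bias_ideal K M CL <= linfun os_class @: lker (linfun (@drop_p N)))%VS.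
  have [] := @two_sided _ _ _ (lker (linfun (@drop_p N))).
  - by move=> y f yN; rewrite !memv_ker !lfunE /= => /eqP f0; rewrite (drop_p_mul lN).
  - by move=> f; rewrite !memv_ker !lfunE /= (drop_p_grading lN) => /eqP->;
    rewrite linear0.
  move=> /prodvP lJ /prodvP rJ; apply: gen_ideal_min.
  - apply/prodvP=> f g _ /memv_imgP[g' g'J ->]; elim/quota_ind: f => f.
    by rewrite lfunE /= -quota_classM -[quota_class _ _]lfunE memv_img ?lJ ?memvf.
  - apply/prodvP=> f g /memv_imgP[f' f'J ->] _; elim/quota_ind: g => g.
    by rewrite lfunE /= -quota_classM -[quota_class _ _]lfunE memv_img ?rJ ?memvf.
  move=> f; rewrite inE => /eqP->.
  rewrite /os_mon -[quota_class _ _]lfunE memv_img // memv_ker lfunE /=.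
  by rewrite drop_pup ?set11.
have /memv_imgP[b] := subvP sub _ aI.
rewrite memv_ker !lfunE /= => /eqP b0 /eqP; rewrite quotv_eq os_idealE => ab.
have := drop_rel lN ab; by rewrite linearB /= (drop_lift_up lN) b0 subr0.
Qed.

Lemma bias_of_surj z : exists a, z = bias_of a.
Proof.
elim/quotv_ind: z => z; elim/quota_ind: z => c; exists (drop_p c); rewrite bias_ofE.
apply: (eq_ext_lin (f := to_bias \o os_class)
          (g := to_bias \o (os_class \o (@lift_up N \o @drop_p N)))) => S SN /=.
elim/set_up_ind: S SN => S SN; first by rewrite (drop_up lN) (lift_up_mon lN).
by rewrite drop_pup ?setU11 // p_rel0 ?setU11 // !linear0.
Qed.

End Presentation.

(** * Injectivity under deletion *)

Definition loopless n (M : matroid n) := forall y, y \in ground M -> rk M [set y] = 1%N.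

Lemma loopfreeP n (M : matroid n) : loopfree M -> loopless M.
Proof.
move=> /forall_inP lM y yM; apply/eqP; rewrite eqn_leq -{1}(cards1 y) rk_card /= lt0n.
apply: contra (lM y yM) => ry; apply/circuitP; split.
- by rewrite sub1set.
- by rewrite indepNE ?sub1set // cards1 (eqP ry).
- by move=> i /set1P->; rewrite setDv indep0.
Qed.

Lemma loopless_delete n (M : matroid n) x : loopless M -> loopless (delete M x).
Proof.
move=> lM y /setD1P[nyx yM]; rewrite -(lM y yM) /=; congr (rk M _).
by apply/setDidPl; rewrite disjoint_sym disjoints1 inE eq_sym.
Qed.

Lemma loopless_lift n (M : matroid n) CL N : is_lift M CL N -> loopless M -> loopless N.
Proof.
move=> lN lM z; have [gN rN _] := lN; rewrite gN => /setU1P[->|].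
  by have := rN set0; rewrite up0 setU0 rk0.
elim/up_ind: z => [|y]; first by rewrite (negbTE (p_notin_up _)).
rewrite mem_up => yM; apply/eqP;
  rewrite eqn_leq -{1}(cards1 (lift ord_max y)) rk_card /=.
by rewrite -(lM y yM) -up1 (lift_rk_up lN).
Qed.

(** The augmentation kills every generator but not [1]. *)
Lemma dep_rel_proper (K : fieldType) m (M : matroid m) (S : {set {set 'I_m}}) :
  S \subset circuits M -> 1 \notin dep_rel K M S.
Proof.
move=> sS; apply/negP=> R1; have : ext_aug (1 : exterior K (ground M)) \in 0%VS.
  move: R1; apply: (dep_rel_lin (f := @ext_aug K m (ground M))) => D dD /=;
    rewrite memv0.
    by rewrite ext_aug_mon; case: (D =P set0) dD => [->|]; rewrite ?indep0.
  rewrite ext_aug_bd //; have /coversP[_ [C [_ CD C1]]] := dD.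
  exact: leq_trans C1 (subset_leq_card CD).
by rewrite memv0 [1]/(ext_mon K _ set0) ext_aug_mon eqxx oner_eq0.
Qed.

Section LooplessIdeal.
Variables (K : fieldType) (n : nat) (N : matroid n).
Hypothesis lN : loopless N.

Lemma loopless_covers (D : {set 'I_n}) : D \subset ground N -> ~~ indep N D ->
  covers N (circuits N) D.
Proof.
move=> DN dD; have [C cC CD] := dep_circuit DN dD; apply/coversP; split=> //.
exists C; split=> //; rewrite ltnNge; apply: contra (circuit_dep cC) => C1.
have /cards1P[y eC] : #|C| == 1%N by rewrite eqn_leq C1 -(circuit_rk cC).
have yN : y \in ground N by have := circuit_ground cC; rewrite eC sub1set.
by rewrite eC /indep sub1set yN lN // cards1.
Qed.

(** Without loops every dependent set covers a circuit of size at least two, so the boundary of a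
    dependent monomial is again a generator. For a smaller class of circuits this can fail. *)
Lemma bd_dep_rel a : a \in dep_rel K N (circuits N) ->
  bd a \in dep_rel K N (circuits N).
Proof.
apply: (dep_rel_lin (f := @bd K n (ground N))) => D dD /=.
  have [DN|/(ext_mon_out K)->] := boolP (D \subset ground N);
    last by rewrite linear0 mem0v.
  by rewrite bd_mon // dep_rel_bd // loopless_covers.
by rewrite -bd_mon ?(covers_ground dD) // bd_bd mem0v.
Qed.

End LooplessIdeal.

Section Inclusion.
Variables (K : fieldType) (n : nat).
Implicit Types (E I X : {set 'I_n}).

Definition incl E E' : exterior K E -> exterior K E' := ext_lin (ext_mon K E').
HB.instance Definition _ E E' :=
  GRing.Linear.copy (@incl E E') (ext_lin (ext_mon K E')).

Lemma incl_mon E E' X : X \subset E -> incl E' (ext_mon K E X) = ext_mon K E' X.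
Proof. exact: ext_linE. Qed.

Lemma incl_bd_mon E E' X : X \subset E -> incl E' (ext_bd K E X) = ext_bd K E' X.
Proof.
move=> XE; rewrite !ext_bdE (linearN (@incl E E')) (linear_sum (@incl E E'));
  congr (- _).
by apply: eq_bigr => i _; rewrite linearZ /= incl_mon // (subset_trans (subD1set _ _)).
Qed.

Lemma incl_bd E E' (a : exterior K E) : E \subset E' -> bd (incl E' a) = incl E' (bd a).
Proof.
move=> EE'; apply: (eq_ext_lin (f := @bd _ _ _ \o @incl E E') (g :=
  @incl E E' \o @bd _ _ _)) => X XE /=.
by rewrite incl_mon // !bd_mon ?incl_bd_mon // (subset_trans XE).
Qed.

Definition mon_span E (P : pred {set 'I_n}) : {vspace exterior K E} :=
  <<[seq ext_mon K E X | X : {set 'I_n} <- enum P]>>.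

Lemma mon_span_mem E (P : pred {set 'I_n}) I : P I -> ext_mon K E I \in mon_span E P.
Proof. by move=> PI; apply: memv_span; apply/mapP; exists I; rewrite // mem_enum. Qed.

Lemma mon_span_lin E (P : pred {set 'I_n}) (V : vectType K)
    (f : {linear exterior K E -> V}) (U : {vspace V}) :
  (forall I, P I -> I \subset E -> f (ext_mon K E I) \in U) ->
  forall a, a \in mon_span E P -> f a \in U.
Proof.
move=> fU; apply: span_lin => a /mapP[I]; rewrite mem_enum => PI ->.
have [IE|/(ext_mon_out K)->] := boolP (I \subset E); first exact: fU.
by rewrite linear0 mem0v.
Qed.

End Inclusion.

(** * Grading by flats *)

Section FlatGrading.
Variables (K : fieldType) (n : nat) (N : matroid n).
Implicit Types (E F I X : {set 'I_n}).

Definition in_flat F I := indep N I && (cl N I == F).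

(** The component at [F] for the grading of the Orlik-Solomon algebra by flats. Dependent monomials,
    being relations, are dropped. *)
Definition flat_part E F : exterior K E -> exterior K E :=
  ext_lin (fun I => if in_flat F I then ext_mon K E I else 0).
HB.instance Definition _ E F := GRing.Linear.copy (@flat_part E F)
  (ext_lin (fun I => if in_flat F I then ext_mon K E I else 0)).

Lemma flat_part_mon E F I :
  flat_part F (ext_mon K E I) = if in_flat F I then ext_mon K E I else 0.
Proof.
have [IE|/(ext_mon_out K)->] := boolP (I \subset E); first exact: ext_linE.
by rewrite linear0 if_same.
Qed.

(** For a dependent [D], every independent [D :\ i] spans the closure of [D]. Up to dependent
    monomials its boundary is thus homogeneous and is either kept or killed as a whole. *)
Lemma flat_part_rel F a : a \in dep_rel K N (circuits N) ->
  flat_part F a \in dep_rel K N (circuits N).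
Proof.
apply: (dep_rel_lin (f := @flat_part (ground N) F)) => D dD /=.
  by rewrite flat_part_mon /in_flat (negbTE dD) mem0v.
have iD := covers_dep (subxx _) dD; have DN := covers_ground dD.
have flatD i : i \in D -> indep N (D :\ i) -> cl N (D :\ i) = cl N D.
  move=> iiD /andP[_ /eqP ri]; apply: cl_eq (subD1set _ _) _.
  apply/eqP; rewrite eqn_leq rk_mono ?subD1set //= ri -ltnS.
  by move: iD; rewrite indepNE // (cardsD1 i D) iiD.
have [clD|clD] := eqVneq (cl N D) F; last first.
  rewrite ext_bdE (linearN (@flat_part (ground N) F)) (linear_sum (@flat_part (ground
    N) F)) /= big1 ?oppr0 ?mem0v //.
  move=> i iiD; rewrite linearZ /= flat_part_mon;
    case: ifP => [/andP[/(flatD i iiD)->]|].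
    by rewrite (negbTE clD).
  by rewrite scaler0.
rewrite -[flat_part F _](subrK (ext_bd K _ D)) memvD ?dep_rel_bd //.
rewrite ext_bdE (linearN (@flat_part (ground N) F)) (linear_sum (@flat_part (ground N)
  F)) /= opprK addrC -sumrB.
rewrite memv_suml // => i iiD; rewrite linearZ /= -scalerBr memvZ // flat_part_mon.
have [iDi|dDi] := boolP (indep N (D :\ i)).
  by rewrite /in_flat iDi (flatD i iiD iDi) clD eqxx subrr mem0v.
by rewrite /in_flat (negbTE dDi) subr0 dep_rel_mon.
Qed.

End FlatGrading.

Section DeletionInjective.
Variables (K : fieldType) (n : nat) (N : matroid n) (x : 'I_n).
Hypothesis lN : loopless N.
Let E := ground N.
Let E' := ground (delete N x).
Let R := dep_rel K N (circuits N).
Let R' := dep_rel K (delete N x) (circuits (delete N x)).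

Lemma flat_part_incl F (a : exterior K E') :
  incl E (flat_part N F a) = flat_part N F (incl E a).
Proof.
apply: (eq_ext_lin (f := @incl K n E' E \o @flat_part _ _ N E' F)
  (g := @flat_part _ _ N E F \o @incl K n E' E)) => X XE /=.
by rewrite incl_mon // !flat_part_mon (fun_if (@incl K n E' E)) linear0 incl_mon.
Qed.

(* Split [a] according to the flats spanned by its monomials.  For the part spanning
   a flat [F] choose [y] in [F] other than [x]: in the homotopy formula, [e_y a] is a
   combination of dependent monomials and [bd a] has smaller degree. *)
Lemma delete_injective (a : exterior K E') : incl E a \in R -> a \in R'.
Proof.
have lN' := loopless_delete (x := x) lN.
suff claim k : forall a : exterior K E',
    a \in mon_span K E' (fun I : {set 'I_n} =>
      (#|I| < k)%N) -> incl E a \in R -> a \in R'.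
  apply: (claim n.+1); apply: (ext_lin_sub (f := idfun)) => X XE /=.
  by apply: mon_span_mem; rewrite /= ltnS -[X in (_ <= X)%N]card_ord max_card.
elim: k => [|k IHk] {}a ak aR.
  rewrite (_ : a = 0) ?mem0v //; apply/eqP; rewrite -memv0; move: ak.
  by apply: (mon_span_lin (f := idfun)).
suff flatR F : flat_part N F a \in R'.
  (* What the flat parts miss is spanned by dependent monomials. *)
  rewrite -[a](subrK (\sum_F flat_part N F a)) memvD ?memv_suml //.
  move: (a); elim/ext_ind=> [c f g IHf IHg||I IE].
  - under eq_bigr do rewrite linearP /=.
    rewrite big_split -scaler_sumr opprD addrACA -scalerBr memvD ?memvZ //.
  - by rewrite big1 ?subr0 ?mem0v // => F _; rewrite linear0.
  under eq_bigr do rewrite flat_part_mon.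
  rewrite -big_mkcond /in_flat /=; have [iI|dI] := boolP (indep N I).
    by rewrite (eq_bigl (pred1 (cl N I))) ?big_pred1_eq ?subrr ?mem0v // => F;
      rewrite eq_sym.
  by rewrite big_pred0 // subr0 dep_rel_mon // indep_delete (negbTE dI).
set b := flat_part N F a;
  have bR : incl E b \in R by rewrite flat_part_incl flat_part_rel.
pose Q (I : {set 'I_n}) := [&& (#|I| < k.+1)%N, I \subset E' & in_flat N F I].
have bQ : b \in mon_span K E' Q.
  move: ak; apply: (mon_span_lin (f := @flat_part K n N E' F)) => I Ik IE /=.
  rewrite flat_part_mon; case: ifP => FI; rewrite ?mem0v //.
  by apply: mon_span_mem; rewrite /Q Ik IE.
have [[y /setD1P[nyx yF]]|F0] : (exists y, y \in (F :&: E) :\ x) \/ (F :&: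
  E) :\ x = set0.
- by have [->|/set0Pn] := eqVneq ((F :&: E) :\ x) set0; [right | left].
- have /setIP[{}yF yE] := yF; have yE' : y \in E' by rewrite !inE nyx.
  rewrite -[b]opprK memvN -(bd_homotopy b yE') memvD //.
    have -> : ext_mon K E' [set y] * b = amull (ext_mon K E' [set y]) b by rewrite
      lfunE.
    move: bQ; apply: (mon_span_lin (f := @bd K n E' \o amull (ext_mon K E' [set y]))).
    move=> I /and3P[_ _ /andP[/andP[_ /eqP rI] /eqP clI]] IE /=;
      rewrite lfunE /= mon1_mul //.
    case: ifPn => yI; first by rewrite linear0 mem0v.
    have yIE : y |: I \subset E' by rewrite subUset sub1set yE'.
    rewrite linearZ memvZ //= bd_mon // dep_rel_bd // loopless_covers //.
    rewrite indep_delete negb_and; apply/orP; left; rewrite indepNE.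
      by move: yF; rewrite -clI inE => /andP[_ /eqP->]; rewrite cardsU1 yI rI.
    exact: subset_trans yIE (subD1set _ _).
  apply: dep_rel_mul => //; apply: IHk;
    last by rewrite -incl_bd ?subD1set // bd_dep_rel.
  move: bQ; apply: (mon_span_lin (f := @bd _ _ _)) => I /andP[Ik _] IE /=.
  rewrite bd_mon // ext_bdE memvN memv_suml // => i iI;
    rewrite memvZ // mon_span_mem //=.
  by move: Ik; rewrite (cardsD1 i I) iI.
(* No [y] is available: [F] has no element but possibly [x], so the only monomial avoiding [x] that
   can span [F] is [1]. Since [1] is not a relation of [N], this part vanishes. *)
have : b \in <[1 : exterior K E']>%VS.
  move: bQ; apply: (mon_span_lin (f := idfun)) =>
    I /and3P[_ IE' /andP[iI /eqP clI]] _ /=.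
  suff -> : I = set0 by apply: memv_line.
  apply/eqP; rewrite -subset0 -F0 -clI subsetD1; move: IE';
    rewrite subsetD1 => /andP[IE ->].
  rewrite andbT subsetI IE andbT; apply/subsetP=> z zI; rewrite inE (subsetP IE) //=.
  by rewrite (setUidPr _) ?sub1set.
case/vlineP=> c eb; have [->|c0] := eqVneq b 0; first exact: mem0v.
case/negP: (dep_rel_proper K (subxx (circuits N))).
move: bR; rewrite eb linearZ /= -[1]/(ext_mon K E' set0) incl_mon ?sub0set //.
move/(memvZ c^-1); rewrite scalerA mulVf ?scale1r //.
by apply: contraNneq c0 => c0; rewrite eb c0 scale0r.
Qed.

End DeletionInjective.

Lemma lc_delete_circuits n (M : matroid n) (CL : {set {set 'I_n}}) x :
  CL \subset circuits M -> lc_delete CL x \subset circuits (delete M x).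
Proof.
move=> sCL; apply/subsetP=> C; rewrite inE circuits_delete => /andP[CCL ->].
by rewrite (subsetP sCL).
Qed.

Lemma lc_contract_circuits n (M : matroid n) (CL : {set {set 'I_n}}) x :
  CL \subset circuits M ->
  rk M [set x] = 1%N -> lc_contract M CL x \subset circuits (contract M x).
Proof.
move=> sCL rx; have xM := nonloop_ground rx.
apply/subsetP=> D /setUP[/imsetP[C /setIdP[/(subsetP sCL) cC xC] ->]|/setIdP[/(subsetP
  sCL) cC xcl]].
  have /circuitP[CM dC minC] := cC; apply/circuitP; split.
  - by rewrite setSD.
  - by rewrite indep_contract // setD1K // negb_and dC orbT.
  move=> i /setD1P[nix iC]; rewrite indep_contract // !inE eqxx andbF /=.
  suff -> : x |: (C :\ x) :\ i = C :\ i by apply: minC.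
  apply/setP=> z; rewrite !inE; case: (z =P x) => [->|]; rewrite ?xC ?andbT //.
  by rewrite eq_sym nix.
have /circuitP[DM dD minD] := cC.
have xD : x \notin D.
  apply: contra xcl => xD; rewrite inE xM (setUidPr _) ?sub1set //=.
have rxD : rk M (x |: D) = #|D|.
  apply/eqP; rewrite eqn_leq -{1}(circuit_rk cC) rkU1 /= -(circuit_rk cC).
  by rewrite ltn_neqAle rk_mono ?subsetUr // andbT; move: xcl; rewrite inE xM eq_sym.
apply/circuitP; split; first by rewrite subsetD1 DM.
  rewrite indep_contract // negb_and; apply/orP; right.
  by apply: contra dD; apply: indep_subset (subsetUr _ _).
move=> i iD; rewrite indep_contract // !inE (negbTE xD) andbF /=.
rewrite /indep subUset sub1set xM (subset_trans (subD1set _ _) DM) /=.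
have cD : #|x |: D :\ i| = #|D|.
  by rewrite cardsU1 !inE (negbTE xD) andbF (cardsD1 i D) iD.
rewrite cD -rxD -(@rkU_span _ M (x |: D :\ i) (D :\ i) D) ?subsetUr ?subD1set //.
  by rewrite -setUA (setUidPr (subD1set _ _)).
have /andP[_ /eqP->] := minD i iD.
by have := circuit_rk cC; rewrite (cardsD1 i D) iD => -[].
Qed.

(** * Multiplication by [e_p] *)

Section Cone.
Variables (K : fieldType) (n : nat) (M : matroid n) (CL : {set {set 'I_n}}).
Variable N : matroid n.+1.
Hypotheses (sCL : CL \subset circuits M) (lN : is_lift M CL N).
Local Notation p := (@ord_max n).
Let gN : ground N = p |: up (ground M). Proof. by case: lN. Qed.

(** This is [- e_p e_X]: moving the last element [p] past [X] costs [(-1) ^+ #|X|]. The remaining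
    sign makes [drop_bd_cone] hold without a factor. *)
Let cone_mon (X : {set 'I_n}) := (-1) ^+ #|X|.+1 *: ext_mon K (ground N) (p |: up X).
Definition cone : exterior K (ground M) -> exterior K (ground N) := ext_lin cone_mon.
HB.instance Definition _ := GRing.Linear.copy cone (ext_lin cone_mon).

Lemma coneE X : cone (ext_mon K (ground M) X) =
  (-1) ^+ #|X|.+1 *: ext_mon K (ground N) (p |: up X).
Proof.
have [XM|XM] := boolP (X \subset ground M); first exact: ext_linE.
by rewrite !ext_mon_out ?linear0 ?scaler0 // gN pupS.
Qed.

Lemma cone_bd X : cone (ext_bd K (ground M) X) =
  (-1) ^+ #|X| *: ext_bd K (ground N) (p |: up X) + ext_mon K (ground N) (up X).
Proof.
rewrite [in RHS]ext_bdE big_setU1 ?p_notin_up //= setU1K ?p_notin_up //.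
rewrite loU1 ?p_notin_up // ltnn add0n lo_p.
rewrite opprD scalerDr !scalerN scalerA -expr2 sqrr_sign scale1r addrAC addNr add0r.
rewrite ext_bdE (linearN cone) (linear_sum cone) /=; congr (- _).
rewrite scaler_sumr big_imset /=; last by move=> i j _ _; apply: lift_inj.
apply: eq_bigr => i iX; rewrite linearZ /= coneE !scalerA mulrC.
rewrite (_ : #|X :\ i|.+1 = #|X|); last by rewrite (cardsD1 i X) iX.
rewrite loU1 ?p_notin_up // lo_up lift_max ltnNge (ltnW (ltn_ord i)) /=.
congr (_ *: ext_mon _ _ _); rewrite upD1.
by apply/setP=> z; rewrite !inE; case: (z =P p) => // ->; rewrite p_lift.
Qed.

(** By [cone_bd], the cone over the boundary of [D] combines the boundary of [p |: up D] with the
    monomial of [up D]. Both are relations of [N], because a circuit in [CL] stays dependent without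
    [p]. *)
Lemma cone_rel a : a \in dep_rel K M CL -> cone a \in dep_rel K N (circuits N).
Proof.
apply: (dep_rel_lin (f := cone)) => D dD /=.
  by rewrite coneE memvZ // dep_rel_mon // (lift_indep_p lN).
rewrite cone_bd; have cD := lift_covers sCL lN dD.
rewrite memvD ?memvZ // ?dep_rel_mon ?(covers_dep (subxx _) cD) // dep_rel_bd //.
by apply: covers_subset cD; rewrite ?subsetUr // gN pupS (covers_ground dD).
Qed.

Lemma drop_bd_cone a : drop_p M (bd (cone a)) = a.
Proof.
apply: (eq_ext_lin (f := @drop_p K n M N \o (@bd _ _ _ \o cone)) (g := idfun)) =>
  X XM /=.
rewrite coneE !linearZ /= bd_mon ?gN ?pupS // (drop_bd_pup K lN).
by rewrite scalerN -scaleNr -mulN1r exprS mulrA mulrNN mulr1 mul1r scalerA -expr2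
  sqrr_sign scale1r.
Qed.

End Cone.

(** The cone trades bias relations for Orlik-Solomon relations of [N], where [delete_injective]
    applies. The way back is [drop_bd_cone], since [bd] and [drop_p] both respect relations. *)
Lemma bias_delete_injective (K : fieldType) n (M : matroid n) (CL :
  {set {set 'I_n}}) x N :
  CL \subset circuits M -> loopless M -> is_lift M CL N ->
  forall a : exterior K (ground (delete M x)), incl (ground M) a \in dep_rel K M CL ->
  a \in dep_rel K (delete M x) (lc_delete CL x).
Proof.
move=> sCL lM lN a aR; have lN' := lift_delete x lN.
have llN := loopless_lift lN lM.
have sCL' := lc_delete_circuits x sCL.
rewrite -(drop_bd_cone lN' a) (drop_rel lN') // bd_dep_rel //.
  exact: loopless_delete.
apply: delete_injective => //.
have -> : incl (ground N) (cone (delete N (lift ord_max x)) a) = cone N (incl (ground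
  M) a).
  apply: (eq_ext_lin (f :=
    @incl _ _ _ _ \o @cone K n (delete M x) (delete N (lift ord_max x)))
    (g := @cone K n M N \o @incl _ _ _ _)) => X XM /=.
  rewrite (coneE K lN') linearZ /= incl_mon; last first.
    by have [/= -> _ _] := lN'; rewrite pupS.
  by rewrite incl_mon // (coneE K lN).
exact: (cone_rel sCL lN).
Qed.

(** * Residues *)

Section Residue.
Variables (K : fieldType) (sg : nat -> K) (n : nat).
Implicit Types (E P I J D : {set 'I_n}) (x y : 'I_n).

(** The sum has a single term; summing avoids naming the element removed. As [sg] depends on the
    degree only, it covers removal from the front and from the back of a monomial at once. *)
Definition residue_mon E' P I : exterior K E' :=
  if #|I :&: P| == 1%N then
    \sum_(y in I :&: P) (sg #|I :\ y| * (-1) ^+ lo y (I :\ y)) *: ext_mon K E' (I :\ y)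
  else 0.

Definition residue E E' P : exterior K E -> exterior K E' := ext_lin (residue_mon E' P).
HB.instance Definition _ E E' P := GRing.Linear.copy (@residue E E' P)
  (ext_lin (residue_mon E' P)).

Lemma residueE E E' P I : I \subset E ->
  residue E' P (ext_mon K E I) = residue_mon E' P I.
Proof. exact: ext_linE. Qed.

Lemma residue1 E E' P I y : I \subset E -> I :&: P = [set y] ->
  residue E' P (ext_mon K E I) =
  (sg #|I :\ y| * (-1) ^+ lo y (I :\ y)) *: ext_mon K E' (I :\ y).
Proof.
by move=> IE IP; rewrite [LHS]ext_linE // /residue_mon IP cards1 eqxx big_set1.
Qed.

Lemma residueN1 E E' P I : I \subset E -> #|I :&: P| != 1%N ->
  residue E' P (ext_mon K E I) = 0.
Proof. by move=> IE IP; rewrite [LHS]ext_linE // /residue_mon (negbTE IP). Qed.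

Lemma residue_bdE E E' P D : D \subset E -> residue E' P (ext_bd K E D) =
  - \sum_(i in D) (-1) ^+ lo i D *: residue E' P (ext_mon K E (D :\ i)).
Proof.
move=> DE; rewrite ext_bdE (linearN (@residue E E' P)) (linear_sum (@residue E E' P)).
by congr (- _); apply: eq_bigr => i _; rewrite linearZ.
Qed.

Section Matroid.
Variables (N : matroid n) (x : 'I_n) (P : {set 'I_n}).
Hypotheses (lN : loopless N) (xN : x \in ground N).
Hypotheses (PN : P \subset ground N) (parP : forall y, y \in P -> rk N [set x;
  y] = 1%N).
Let E := ground N.
Let E' := ground (contract N x).
Let rx := lN xN.

(** Independence of [D :\ y] in the contraction means that of [x |: D :\ y] in [N], where the
    parallel element [y] may replace [x]. *)
Lemma parallel_contract_dep D y : y \in P -> y \in D -> ~~ indep N D ->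
  ~~ indep (contract N x) (D :\ y).
Proof.
move=> yP yD; apply: contra; rewrite indep_contract // => /andP[xDy].
have ry := lN (subsetP PN y yP).
have r1 : rk N (x |: D :\ y) = rk N D.
  rewrite -(@rkU_span _ N D [set y] [set x; y]) ?sub1set ?inE ?eqxx ?orbT ?parP //.
  rewrite -(@rkU_span _ N (x |: D :\ y) [set x] [set x;
    y]) ?sub1set ?inE ?eqxx ?parP //.
  congr (rk N _); apply/setP=> z; rewrite !inE; case: (z =P x); rewrite ?orbT //= => _.
  by case: (z =P y) => [->|]; rewrite ?yD ?orbT //= orbF.
rewrite /indep r1 cardsU1 xDy (cardsD1 y D) yD => /andP[];
  rewrite subUset => /andP[_ sE] ->.
by rewrite andbT -(setD1K yD) subUset sub1set (subsetP PN).
Qed.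

Lemma residue_dep D S : ~~ indep N D ->
  residue E' P (ext_mon K E D) \in dep_rel K (contract N x) S.
Proof.
move=> dD; have [DE|/(ext_mon_out K)->] := boolP (D \subset E);
  last by rewrite linear0 mem0v.
have [/cards1P[y DP]|DP] := boolP (#|D :&: P| == 1%N); last by rewrite residueN1 ?mem0v.
have /setIP[yD yP] : y \in D :&: P by rewrite DP set11.
by rewrite (residue1 _ DE DP) memvZ // dep_rel_mon // parallel_contract_dep.
Qed.

Hypothesis fullP : forall y, y \in E -> rk N [set x; y] = 1%N -> y \in P.

Let xP : x \in P.
Proof. by rewrite fullP // setUid. Qed.

(** For the boundary of [D], count the elements of [D] in [P]. With one element [y], the residue is
    a multiple of the boundary of [D :\ y]; with two, the terms removing them cancel; otherwise
    every term vanishes. *)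
Lemma residue_rel a : a \in dep_rel K N (circuits N) ->
  residue E' P a \in dep_rel K (contract N x) (circuits (contract N x)).
Proof.
apply: (dep_rel_lin (f := @residue E E' P)) => D cD /=; first exact: residue_dep.
have dD := covers_dep (subxx _) cD; have DE := covers_ground cD.
have DiE i : D :\ i \subset E by apply: subset_trans (subD1set _ _) DE.
have DiP i : (D :\ i) :&: P = (D :&: P) :\ i by rewrite setIC setIDA setIC.
rewrite residue_bdE // memvN.
have out i : i \in D -> #|(D :&: P) :\ i| != 1%N ->
    (-1) ^+ lo i D *: residue E' P (ext_mon K E (D :\ i)) = 0.
  by move=> iD ci; rewrite residueN1 ?scaler0 // DiP.
have cDP i : #|D :&: P| = ((i \in D :&: P) + #|(D :&: P) :\ i|)%N by apply: cardsD1.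
have [/cards1P[y DP]|nDP1] := boolP (#|D :&: P| == 1%N).
  have /setIP[yD yP] : y \in D :&: P by rewrite DP set11.
  have yoff i : i \in D :\ y -> i \notin P.
    move=> /setD1P[niy iD]; apply: contra niy => iP.
    by have := set11 y; rewrite -DP -in_set1 -DP !inE iD iP.
  rewrite (bigD1 y) //= out ?DP ?setDv ?cards0 // add0r.
  have -> : \sum_(i in D | i != y) (-1) ^+ lo i D *:
    residue E' P (ext_mon K E (D :\ i)) =
      (sg #|D :\ y|.-1 * (-1) ^+ lo y (D :\ y)) *: ext_bd K E' (D :\ y).
    rewrite ext_bdE -sumrN scaler_sumr; apply: eq_big => [i|i /andP[iD niy]].
      by rewrite !inE andbC.
    have iDy : i \in D :\ y by rewrite !inE niy.
    have DiP1 : (D :\ i) :&: P = [set y].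
      by rewrite DiP DP; apply/setDidPl; rewrite disjoint_sym disjoints1 inE.
    rewrite (residue1 _ (DiE i) DiP1) -scaleNr !scalerA.
    have -> : D :\ i :\ y = D :\ y :\ i by rewrite !setDDl setUC.
    rewrite (cardsD1 i (D :\ y)) iDy /= (loD1 i yD) (loD1 y iDy).
    congr (_ *: _); rewrite !exprD.
    have -> : (y < i)%N = ~~ (i < y)%N :> bool.
      by case: ltngtP niy => // /val_inj->; rewrite eqxx.
    by case: (i < y)%N; rewrite /= ?expr0 ?expr1; ring.
  rewrite memvZ // dep_rel_bd //; have DyE' : D :\ y \subset E'.
    rewrite subsetD1 (subset_trans (subD1set _ _) DE) /=.
    by apply/negP=> /yoff; rewrite xP.
  have [C cC CD] := dep_circuit DyE' (parallel_contract_dep yP yD dD).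
  (* A circuit of size one is a loop of the contraction, hence parallel to [x] and in [P], but [D]
     meets [P] only in [y]. *)
  apply/coversP; split=> //; exists C; split=> //; rewrite ltnNge.
  apply/negP=> C1; have /cards1P[z eC] :
    #|C| == 1%N by rewrite eqn_leq C1 -(circuit_rk cC).
  have zD : z \in D :\ y by rewrite (subsetP CD) // eC set11.
  have zE : z \in E by have /setD1P[_ /(subsetP DE)] := zD.
  case/negP: (yoff z zD); apply: fullP => //.
  have := circuit_rk cC; rewrite eC cards1 /= rx => -[/eqP].
  rewrite subn_eq0 => le1; apply/eqP; rewrite eqn_leq le1 -{1}rx rk_mono //.
  by rewrite subsetUl.
have [/cards2P[y [z [nyz DP]]]|nDP2] := boolP (#|D :&: P| == 2%N); last first.
  rewrite big1 ?mem0v // => i iD; apply: out => //.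
  move: nDP1 nDP2; rewrite (cDP i); case: (i \in D :&: P); rewrite ?add0n ?add1n //.
have /setIP[yD yP] : y \in D :&: P by rewrite DP !inE eqxx.
have /setIP[zD zP] : z \in D :&: P by rewrite DP !inE eqxx orbT.
have yDz : y \in D :\ z by rewrite !inE nyz.
have zDy : z \in D :\ y by rewrite !inE eq_sym nyz.
rewrite (bigD1 y) //= (bigD1 z) ?zDy //=; last by rewrite zD eq_sym.
rewrite big1 ?addr0 => [|i /andP[/andP[iD niy] niz]]; last first.
  apply: out => //; rewrite (_ : _ :\ i = D :&: P) ?DP ?cards2 ?nyz //.
  by apply/setDidPl; rewrite disjoint_sym disjoints1 !inE negb_or niy.
have DyP : (D :\ y) :&: P = [set z].
  by rewrite DiP DP setU1K // inE.
have DzP : (D :\ z) :&: P = [set y].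
  by rewrite DiP DP setUC setU1K // inE eq_sym.
rewrite (residue1 _ (DiE y) DyP) (residue1 _ (DiE z) DzP).
have -> : D :\ z :\ y = D :\ y :\ z by rewrite !setDDl setUC.
rewrite !scalerA -scalerDl [X in X *: _](_ : _ = 0) ?scale0r ?mem0v //.
rewrite (loD1 y zD) (loD1 z yD) (loD1 y yDz) (loD1 z zDy) !ltnn !add0n.
have -> : D :\ z :\ y = D :\ y :\ z by rewrite !setDDl setUC.
rewrite !exprD; have -> : (z < y)%N = ~~ (y < z)%N :> bool.
  by case: ltngtP nyz => // /val_inj->; rewrite eqxx.
by case: (y < z)%N; rewrite /= ?expr0 ?expr1; ring.
Qed.

End Matroid.

End Residue.

(** * Residues on relations of the bias algebra *)

Section BiasResidue.
Variables (K : fieldType) (sg : nat -> K) (n : nat).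
Variables (M : matroid n) (CL : {set {set 'I_n}}) (x : 'I_n).
Hypotheses (sCL : CL \subset circuits M) (lM : loopless M) (xM : x \in ground M).
Variable N : matroid n.+1.
Hypothesis lN : is_lift M CL N.
Let rx := lM xM.

(** The parallel class of [x] in the lift. A two-element circuit outside [CL] is parallel in [M] but
    becomes independent in [N]. *)
Definition bias_parallel := x |: [set y | [set x; y] \in CL].
Let P := bias_parallel.

Lemma bias_parallel_ground : P \subset ground M.
Proof.
rewrite subUset sub1set xM /=; apply/subsetP=> y; rewrite inE => /(subsetP sCL).
by move/circuit_ground/subsetP; apply; rewrite !inE eqxx orbT.
Qed.

Lemma bias_parallel_rk y : y \in P -> rk M [set x; y] = 1%N.
Proof.
case/setU1P=> [->|]; first by rewrite setUid.
rewrite inE => /(subsetP sCL) cxy; have := circuit_rk cxy; rewrite cards2.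
case: eqP => [exy|_ [] //]; move: cxy; rewrite exy setUid => /circuit_dep.
by rewrite /indep sub1set -exy xM rx cards1.
Qed.

Let x' := lift ord_max x.

Lemma lift_parallel (z : 'I_n.+1) : z \in ground N -> rk N [set x'; z] = 1%N ->
  z \in up P.
Proof.
have [gN rN cN] := lN; elim/up_ind: z => [_|y].
  by rewrite setUC -up1 rN rx.
rewrite gN !inE lift_p !mem_up /= => yM; rewrite -(up1 y) -upU1 => r1.
apply/setU1P; have [->|nyx] := eqVneq y x; first by left.
right; rewrite inE; have xyM : [set x;
  y] \subset ground M by rewrite subUset !sub1set xM.
have cxy : [set x; y] \in circuits M.
  apply/circuitP; split=> // [|i].
    by rewrite indepNE // cards2 eq_sym nyx ltnS (leq_trans (lift_rk_up lN _)) ?r1.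
  case/set2P=> ->.
    by rewrite setU1K ?inE 1?eq_sym // /indep sub1set yM lM // cards1.
  by rewrite setUC setU1K ?inE // /indep sub1set xM rx cards1.
rewrite cN // indepNE; last by rewrite gN up_pupS.
by rewrite r1 card_up cards2 eq_sym nyx.
Qed.

Lemma lift_parallel_rk (z : 'I_n.+1) : z \in up P -> rk N [set x'; z] = 1%N.
Proof.
have llN := loopless_lift lN lM; have [gN rN cN] := lN.
case/imsetP=> y /setU1P[->|yCL] -> {z};
  first by rewrite setUid llN // gN inE mem_up xM orbT.
have xyCL : [set x; y] \in CL by rewrite inE in yCL.
have cxy := subsetP sCL _ xyCL.
rewrite -(up1 y) -upU1; apply/eqP; rewrite eqn_leq -{2}(bias_parallel_rk (y := y));
  last first.
  by rewrite !inE xyCL orbT.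
rewrite (lift_rk_up lN) andbT; move: xyCL; rewrite cN // indepNE; last first.
  by rewrite gN up_pupS circuit_ground.
by rewrite card_up -(circuit_rk cxy) bias_parallel_rk // in_setU1 yCL orbT.
Qed.

Lemma residue_lift_up a :
  residue sg (ground (contract N x')) (up P) (lift_up N a) =
  lift_up (contract N x') (residue sg (ground (contract M x)) P (a :
    exterior K (ground M))).
Proof.
have [gN _ _] := lN; have lNc := lift_contract lN sCL rx.
apply: (eq_ext_lin (f := @residue K sg _ _ _ (up P) \o @lift_up K n M N)
  (g := @lift_up K n (contract M x) (contract N x') \o @residue K sg _ _ _ P)) =>
    I IM /=.
rewrite (lift_up_mon K lN) !residueE ?gN ?up_pupS //.
have IP : up I :&: up P = up (I :&: P).
  apply/setP; elim/up_ind=> [|z]; rewrite ?inE ?mem_up ?inE //.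
  by rewrite !(negbTE (p_notin_up _)).
rewrite /residue_mon IP card_up; case: ifP => _; last by rewrite linear0.
rewrite big_imset /=; last by move=> i j _ _; apply: lift_inj.
rewrite linear_sum; apply: eq_bigr => y _.
by rewrite linearZ /= (lift_up_mon K lNc) -!upD1 card_up lo_up.
Qed.

(** Boundaries are treated in [N], where [up P] is the full parallel class that [residue_rel]
    requires; in [M] it may be only part of the class of [x]. *)
Lemma residue_bias_rel a : a \in dep_rel K M CL ->
  residue sg (ground (contract M x)) P a \in dep_rel K (contract M x) (lc_contract M CL
    x).
Proof.
have [gN _ _] := lN; have lNc := lift_contract lN sCL rx.
apply: (dep_rel_lin (f := @residue K sg _ _ _ P)) => D dD /=.
  apply: residue_dep => //; [exact: bias_parallel_ground | exact: bias_parallel_rk].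
rewrite -[residue _ _ _ _](drop_lift_up lNc) (drop_rel lNc) // -residue_lift_up.
apply: residue_rel.
- exact: loopless_lift lN lM.
- by rewrite gN inE mem_up xM orbT.
- by rewrite gN up_pupS bias_parallel_ground.
- exact: lift_parallel_rk.
- exact: lift_parallel.
by rewrite (lift_up_bd K lN) dep_rel_bd // (lift_covers sCL lN).
Qed.

End BiasResidue.

(** * The exact sequence *)

Lemma linear_factor (K : fieldType) (U V W : vectType K)
    (f : {linear U -> V}) (g : {linear U -> W}) :
  (forall v, exists u, v = f u) -> (forall u, f u = 0 -> g u = 0) ->
  exists h : 'Hom(V, W), forall u, h (f u) = g u.
Proof.
move=> surj fg; exists (linfun g \o (linfun f)^-1)%VF => u.
rewrite comp_lfunE lfunE /=; apply/eqP; rewrite -subr_eq0 -linearB /=; apply/eqP/fg.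
apply/eqP; rewrite linearB /= subr_eq0; apply/eqP.
have fuK : f u \in limg (linfun f) by rewrite -[f u]lfunE memv_img ?memvf.
by have := limg_lfunVK fuK; rewrite lfunE.
Qed.

(** * Signs of the projection *)

Section SortSign.
Variable n : nat.
Implicit Types (s : seq 'I_n) (J I : {set 'I_n}) (x y : 'I_n).

Let lt : rel 'I_n := fun a b => (a < b)%N.

Lemma enum_pairwise J : pairwise lt (enum J).
Proof.
have tr : transitive lt by move=> a b c; apply: ltn_trans.
rewrite -(sorted_pairwise tr) {1}/enum_mem -enumT /=.
apply: (subseq_sorted tr (filter_subseq _ _)).
have := iota_ltn_sorted 0 n; rewrite -val_enum_ord sorted_map.
by [].
Qed.

Lemma seq_inversions_cat s1 s2 : seq_inversions (s1 ++ s2) =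
  (seq_inversions s1 + seq_inversions s2 +
   \sum_(a <- s1) count (fun b : 'I_n => (b < a)%N) s2)%N.
Proof.
elim: s1 => [|a s1 IH] /=; first by rewrite big_nil addn0.
by rewrite count_cat IH big_cons; ring.
Qed.

Lemma seq_inversions_pairwise s : pairwise lt s -> seq_inversions s = 0%N.
Proof.
elim: s => //= a s IH /andP[/allP as_ /IH->]; rewrite addn0.
by apply/eqP; rewrite -leqn0 leqNgt -has_count; apply/hasPn=> b /as_;
  rewrite -leqNgt => /ltnW.
Qed.

Lemma count_enum (P : pred 'I_n) J : count P (enum J) = #|[set k in J | P k]|.
Proof.
rewrite cardE -size_filter; apply/perm_size/uniq_perm => [||k].
- exact/filter_uniq/enum_uniq.
- exact: enum_uniq.
by rewrite mem_filter !mem_enum inE andbC.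
Qed.

Lemma lo_hi x J : x \notin J -> (lo x J + #|[set k in J | (x < k)%N]|)%N = #|J|.
Proof.
move=> xJ; rewrite -(cardsID [set k : 'I_n | (k < x)%N] J); congr (_ + _)%N.
  by apply: eq_card => k; rewrite !inE.
apply: eq_card => k; rewrite !inE -leqNgt andbC; case: (boolP (k \in J));
  rewrite ?andbF ?andbT //.
by move=> kJ; rewrite ltn_neqAle val_eqE; case: eqP kJ xJ => // -> ->.
Qed.

(** Moving a factor from the front to the back passes the [k] other factors. *)
Definition side_sign (K : fieldType) (front : bool) k : K :=
  if front then 1 else (-1) ^+ k.

Lemma move_signE (K : fieldType) x front J : x \notin J ->
  move_sign K x front J = side_sign K front #|J| * (-1) ^+ lo x J.
Proof.
move=> xJ; rewrite /move_sign /sort_sign /side_sign; case: front.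
  by rewrite /= seq_inversions_pairwise ?enum_pairwise // addn0 count_enum mul1r.
rewrite -cats1 seq_inversions_cat seq_inversions_pairwise ?enum_pairwise //= !add0n.
under eq_bigr do rewrite addn0.
rewrite -(lo_hi xJ) exprD mulrC mulrA -expr2 sqrr_sign mul1r; congr (_ ^+ _).
by rewrite -count_enum -sumn_count sumnE big_map.
Qed.

(** Putting [x] in the slot of [y], sorting, and then moving [x] to the front amounts to moving the
    content of that slot to the front directly. *)
Lemma replace_signE (K : fieldType) x y I : x \notin I -> y \in I ->
  replace_sign K x y I * (-1) ^+ lo x (I :\ y) = (-1) ^+ lo y (I :\ y).
Proof.
move=> xI yI; have := enum_pairwise I; have := enum_uniq I.
have eJ P : count P (enum (I :\ y)) = count P (rem y (enum I)).
  apply/permP: P; apply: uniq_perm; rewrite ?rem_uniq ?enum_uniq // => k.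
  by rewrite mem_rem_uniq ?enum_uniq // !inE !mem_enum !inE.
rewrite /replace_sign /lo -!count_enum !eJ.
have sI k : k \in enum I -> k != x by rewrite mem_enum; apply: contraTneq => ->.
have yE : y \in enum I by rewrite mem_enum.
move: (enum I) yE sI {eJ} => e yE sI; case/splitPr: yE sI => s1 s2 sI.
rewrite cat_uniq /= negb_or -!andbA => /and5P[_ ys1 _ ys2 _].
have -> : rem y (s1 ++ y :: s2) = s1 ++ s2.
  elim: s1 ys1 {sI} => [|a s1 IH] /=; rewrite ?eqxx // inE negb_or => /andP[nya /IH->].
  by rewrite eq_sym (negbTE nya).
rewrite pairwise_cat /= => /and3P[/allrelP l12 p1 /andP[/allP ly2 p2]].
have out s : y \notin s -> [seq if z == y then x else z | z <- s] = s.
  by move=> ys; apply: map_id_in => z zs; case: eqP ys => // <-; rewrite zs.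
rewrite map_cat /= eqxx !out // /sort_sign seq_inversions_cat /=
  !seq_inversions_pairwise //.
rewrite !count_cat add0n addn0.
have -> : \sum_(a <- s1) ((x < a)%N + count (fun b : 'I_n => (b < a)%N) s2)%N =
    count (fun a : 'I_n => (x < a)%N) s1.
  rewrite -sumn_count sumnE big_map; apply: eq_big_seq => a as1.
  rewrite [count _ _](_ : _ = 0%N) ?addn0 //.
  apply/eqP; rewrite -leqn0 leqNgt -has_count; apply/hasPn=> b bs2;
    rewrite -leqNgt ltnW //.
  by apply: l12; rewrite // inE bs2 orbT.
have -> : (count (fun k : 'I_n => (k < y)%N) s1 = size s1).
  by apply/eqP; rewrite -all_count; apply/allP=> a as1; apply: l12; rewrite // mem_head.
have -> : (count (fun k : 'I_n => (k < y)%N) s2 = 0%N).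
  by apply/eqP; rewrite -leqn0 leqNgt -has_count; apply/hasPn=> b /ly2;
    rewrite -leqNgt => /ltnW.
have -> : size s1 = (count (fun a : 'I_n => (x < a)%N) s1 + count (fun k : 'I_n =>
  (k < x)%N) s1)%N.
  rewrite -[LHS](count_predC (fun a : 'I_n => (x < a)%N)); congr (_ + _)%N.
  apply: eq_in_count => a as1 /=;
    rewrite -leqNgt leq_eqVlt val_eqE (negbTE (sI a _)) //.
  by rewrite mem_cat as1.
rewrite -exprD -[LHS]signr_odd -[RHS]signr_odd; congr (_ ^+ (nat_of_bool _)).
by rewrite !oddD; do 3!case: (odd _).
Qed.

End SortSign.

(** * The two maps and their exactness *)

Section MinorSequence.
Variables (K : fieldType) (n : nat) (M : matroid n) (CL : {set {set 'I_n}}).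
Variables (x : 'I_n) (front : bool).
Hypotheses (lM : loopless M) (xM : x \in ground M).
Hypotheses (lCL : linear_class M CL).
Implicit Types (I J D : {set 'I_n}) (y : 'I_n).

Let sCL : CL \subset circuits M. Proof. by case: lCL. Qed.
Let rx := lM xM.
Let M' := delete M x.
Let M'' := contract M x.
Let CL' := lc_delete CL x.
Let CL'' := lc_contract M CL x.
Let sCL' : CL' \subset circuits M' := lc_delete_circuits x sCL.
Let sCL'' : CL'' \subset circuits M'' := lc_contract_circuits sCL rx.
Let N := elementary_lift lCL.
Let lN : is_lift M CL N := elementary_liftP lCL.
Let exN : exists N, is_lift M CL N. Proof. by exists N. Qed.
(** Minors of the lift are lifts of the minors, so all three bias algebras have the presentation by
    relations. *)
Let exN' : exists N, is_lift M' CL' N.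
Proof. by exists (delete N (lift ord_max x)); apply: lift_delete. Qed.
Let exN'' : exists N, is_lift M'' CL'' N.
Proof. by exists (contract N (lift ord_max x)); apply: lift_contract. Qed.

Local Notation Z := (bias_algebra K M CL).
Local Notation Z' := (bias_algebra K M' CL').
Local Notation Z'' := (bias_algebra K M'' CL'').
Local Notation E := (ground M).
Local Notation E' := (ground M').
Local Notation E'' := (ground M'').
Local Notation P := (bias_parallel CL x).
Local Notation sg := (side_sign K front).
Local Notation mu := (@bias_of K n M CL).
Local Notation mu' := (@bias_of K n M' CL').
Local Notation mu'' := (@bias_of K n M'' CL'').
Local Notation res := (@residue K sg n E E'' P).

Lemma inclusion_exists : exists i : 'Hom(Z', Z),
  forall a, i (mu' a) = mu (incl E a).
Proof.
apply: (linear_factor (f := mu') (g := mu \o @incl K n E' E)).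
  exact: bias_of_surj.
move=> a /eqP; rewrite bias_of_eq0 // => aR /=; apply/eqP; rewrite bias_of_eq0 //.
move: a aR; apply: (dep_rel_lin (f := @incl K n E' E)) => D dD /=.
  have [DE|/(ext_mon_out K)->] := boolP (D \subset E'); last by rewrite linear0 mem0v.
  rewrite incl_mon // dep_rel_mon //; apply: contra dD; rewrite indep_delete => ->.
  by move: DE; rewrite subsetD1 => /andP[].
have DE' := covers_ground dD; rewrite incl_bd_mon //; apply/dep_rel_bd/coversP.
have /coversP[_ [C [/setIdP[CCL _] CD C1]]] := dD.
by split; [exact: subset_trans DE' (subD1set _ _) | exists C].
Qed.

Lemma projection_exists : exists p : 'Hom(Z, Z''), forall a, p (mu a) = mu'' (res a).
Proof.
apply: (linear_factor (f := mu) (g := mu'' \o res)); first exact: bias_of_surj.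
move=> a /eqP; rewrite bias_of_eq0 // => aR /=; apply/eqP; rewrite bias_of_eq0 //.
exact: (residue_bias_rel sg sCL lM xM lN aR).
Qed.

Lemma parallel_dep J z : z \in J -> z \in P -> ~~ indep M'' J.
Proof.
move=> zJ zP; rewrite indep_contract // negb_and negbK.
have [//|xJ /=] := boolP (x \in J).
suff : ~~ indep M [set x; z].
  by apply: contra; apply: indep_subset; rewrite setUS // sub1set.
have nxz : x != z by apply: contraNneq xJ => ->.
rewrite indepNE ?(bias_parallel_rk sCL lM xM zP) ?cards2 ?nxz //.
by rewrite subUset !sub1set xM (subsetP (bias_parallel_ground sCL xM)).
Qed.

Section Inclusion.
Variable i : 'Hom(Z', Z).
Hypothesis iE : forall a, i (mu' a) = mu (incl E a).

Lemma inclusion_unique : unique (@is_inclusion_map K n M CL x) i.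
Proof.
have iI : is_inclusion_map i.
  move=> I iI; rewrite -(bias_of_mon K exN') iE incl_mon ?(bias_of_mon K exN) //.
  by case/andP: iI.
split=> // j jI; apply/lfunP=> v; have [a ->] := bias_of_surj exN' v.
apply: (eq_ext_lin (f := i \o mu') (g := j \o mu')) => I _ /=.
rewrite (bias_of_mon K exN'); have [indI|depI] := boolP (indep M' I).
  by rewrite iI // jI.
by rewrite bias_mon_dep // !linear0.
Qed.

Lemma inclusion_inj : lker i = 0%VS.
Proof.
apply/eqP; rewrite -subv0; apply/subvP=> v; have [a ->] := bias_of_surj exN' v.
rewrite memv_ker iE bias_of_eq0 // memv0 bias_of_eq0 // => aR.
exact: (bias_delete_injective sCL lM lN).
Qed.

End Inclusion.

Section Projection.
Variable p : 'Hom(Z, Z'').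
Hypothesis pE : forall a, p (mu a) = mu'' (res a).
Let e I := bias_mon K M CL I.
Let e'' I := bias_mon K M'' CL'' I.

Let c y J := sg #|J| * (-1) ^+ lo y J.

Lemma projection_sign_neq0 y J : c y J != 0.
Proof. by rewrite /c /side_sign; case: front; rewrite ?mul1r -?exprD ?signr_eq0. Qed.

Let c_sqr y J : c y J * c y J = 1.
Proof.
rewrite /c mulrACA -[(-1) ^+ _ * _]expr2 sqrr_sign mulr1 /side_sign.
by case: front; rewrite ?mulr1 // -expr2 sqrr_sign.
Qed.

(** The formula holds for any choice of [y]: if [I] meets [P] in a second element, the residue is
    zero, and so is [e'' (I :\ y)] by [parallel_dep]. *)
Lemma projection_mon I y : I \subset E -> y \in I -> y \in P ->
  p (e I) = c y (I :\ y) *: e'' (I :\ y).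
Proof.
move=> IE yI yP; rewrite /e -(bias_of_mon K exN) pE.
have [IP|/eqP IP] := eqVneq (I :&: P) [set y].
  by rewrite (residue1 _ _ IE IP) linearZ /= (bias_of_mon K exN'').
have /subsetPn[z /setIP[zI zP]] : ~~ (I :&: P \subset [set y]).
  by apply: contra_notN IP => sIP; apply/eqP; rewrite eqEsubset sIP sub1set inE yI.
rewrite inE => nzy; have zIy : z \in I :\ y by rewrite !inE nzy.
rewrite /e'' (bias_mon_dep K exN'' (parallel_dep zIy zP)) scaler0 residueN1 ?linear0 //.
apply: contra_notN IP => /cards1P[w IP]; have : y \in I :&: P by rewrite inE yI.
by rewrite IP => /set1P->.
Qed.

Lemma projection_mon0 I : I \subset E -> [disjoint I & P] -> p (e I) = 0.
Proof.
move=> IE; rewrite -setI_eq0 => /eqP IP.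
by rewrite /e -(bias_of_mon K exN) pE residueN1 ?linear0 // IP cards0.
Qed.

Lemma projection_unique : E = [set: 'I_n] ->
  unique (@is_projection_map K n M CL x front) p.
Proof.
move=> ET; have subE I : I \subset E by rewrite ET subsetT.
have xP : x \in P by rewrite setU11.
have P_CL y : [set x; y] \in CL -> y \in P by move=> xy; rewrite !inE xy orbT.
have pI : is_projection_map front p.
  move=> I; split=> [xI|y xI yI xyCL|xI noCL].
  - by rewrite move_signE ?(projection_mon (subE I) xI xP) // !inE eqxx.
  - rewrite move_signE ?inE ?(negbTE xI) ?andbF // mulrCA replace_signE //.
    exact: projection_mon (P_CL y xyCL).
  apply: projection_mon0 => //; rewrite -setI_eq0; apply/eqP/setP=> y; rewrite !inE.
  apply/andP=> -[yI /orP[/eqP yx|xy]]; first by rewrite yx (negbTE xI) in yI.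
  by case/negP: (noCL y yI).
split=> // q qI; apply/lfunP=> v; have [a ->] := bias_of_surj exN v.
apply: (eq_ext_lin (f := p \o mu) (g := q \o mu)) => I _ /=.
rewrite (bias_of_mon K exN); have [p1 p2 p3] := pI I; have [q1 q2 q3] := qI I.
have [xI|xI] := boolP (x \in I); first by rewrite p1 ?q1.
have [/existsP[y /andP[yI yCL]]|/existsPn no] := boolP [exists y, (y \in I) && ([set x;
  y] \in CL)].
  by rewrite (p2 y) ?(q2 y).
have noCL y : y \in I -> [set x; y] \notin CL by move=> yI; have := no y; rewrite yI.
by rewrite p3 ?q3.
Qed.

Lemma projection_surj : limg p = fullv.
Proof.
apply/eqP; rewrite eqEsubv subvf /=; apply/subvP=> z _.
have [a ->] := bias_of_surj exN'' z.
apply: (ext_lin_sub (f := mu'')) => J; rewrite subsetD1 => /andP[JE xJ] /=.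
have xJE : x |: J \subset E by rewrite subUset sub1set xM.
have := projection_mon xJE (setU11 x J) (setU11 x _); rewrite setU1K // => pJ.
rewrite (bias_of_mon K exN'') -[bias_mon _ _ _ _]scale1r -(mulVf (projection_sign_neq0
  x J)) -scalerA.
by rewrite memvZ // -pJ memv_img ?memvf.
Qed.

(* For [P = {x}], subtracting [section_mon (residue a)] from [a] leaves only
   monomials that avoid [x]. *)
Let section_mon J : exterior K E := c x J *: ext_mon K E (x |: J).

Lemma projection_exact (i : 'Hom(Z', Z)) : (forall a, i (mu' a) = mu (incl E a)) ->
  (forall y, [set x; y] \notin CL) -> limg i = lker p.
Proof.
move=> iE noCL; have Px : P = [set x].
  by apply/setP=> y; rewrite !inE (negbTE (noCL y)) orbF.
have im_mon I : I \subset E -> x \notin I -> mu (ext_mon K E I) \in limg i.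
  move=> IE xI; have IE' : I \subset E' by rewrite subsetD1 IE.
  by rewrite -(incl_mon K E IE') -iE memv_img ?memvf.
apply/eqP; rewrite eqEsubv; apply/andP; split; apply/subvP=> v.
  case/memv_imgP=> w _ ->; have [a ->] := bias_of_surj exN' w;
    rewrite iE memv_ker -memv0.
  apply: (ext_lin_sub (f := p \o (mu \o @incl K n E' E))) => I;
    rewrite subsetD1 => /andP[IE xI] /=.
  rewrite incl_mon ?subsetD1 ?IE // (bias_of_mon K exN) projection_mon0 ?mem0v //.
  by rewrite Px disjoint_sym disjoints1.
have [a ->] := bias_of_surj exN v; rewrite memv_ker pE bias_of_eq0 // => aR.
rewrite -[mu a](subrK (mu (ext_lin section_mon (res a)))) memvD //.
  rewrite -linearB; move: (a).
  apply: (ext_lin_sub (f := mu \o (idfun \- (ext_lin section_mon \o res)))) => I IE /=.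
  have [xI|xI] := boolP (x \in I); last first.
    have IP0 : I :&: P = set0 by apply/eqP; rewrite Px setI_eq0 disjoint_sym disjoints1.
    by rewrite residueN1 ?IP0 ?cards0 // linear0 subr0 im_mon.
  have IP : I :&: P = [set x] by rewrite Px; apply/setIidPr; rewrite sub1set.
  rewrite (residue1 _ _ IE IP) linearZ /= ext_linE ?setSD // /section_mon scalerA
    setD1K //.
  by rewrite c_sqr scale1r subrr linear0 mem0v.
move: aR; apply: (dep_rel_lin (f := mu \o ext_lin section_mon)) => D dD /=.
  have [DE|/(ext_mon_out K)->] := boolP (D \subset E''); last by rewrite !linear0 mem0v.
  move: (DE); rewrite subsetD1 => /andP[_ xD].
  rewrite ext_linE // linearZ /= (bias_of_mon K exN) bias_mon_dep ?scaler0 ?mem0v //.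
  by move: dD; rewrite indep_contract // xD.
have /coversP[DE [C [CCL CD C1]]] := dD; move: (DE); rewrite subsetD1 => /andP[DM xD].
have xDE : x |: D \subset E by rewrite subUset sub1set xM.
have -> : ext_lin section_mon (ext_bd K E'' D) =
    sg #|D|.-1 *: (ext_mon K E [set x] * bd (ext_mon K E D)).
  rewrite bd_mon // !ext_bdE mulrN mulr_sumr scalerN scaler_sumr.
  rewrite (linearN (ext_lin section_mon)) (linear_sum (ext_lin section_mon));
    congr (- _).
  apply: eq_bigr => j jD; rewrite linearZ /= ext_linE ?(subset_trans (subD1set _ _)) //.
  rewrite -scalerAr mon1_mul ?(subset_trans (subD1set _ _)) //.
  rewrite !inE (negbTE xD) andbF !scalerA (cardsD1 j D) jD /=; congr (_ *: _).
  by rewrite /c; ring.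
(* In the homotopy formula, [e_D] avoids [x] and lies in the image of [i], while [x |: D] contains a
   member of [CL] of size at least two, which makes its boundary a relation of [M]. *)
rewrite linearZ memvZ //=;
  move: (bd_homotopy (ext_mon K E D) xM) => /(canRL (addKr _))->.
rewrite linearD linearN memvD ?memvN //=; last by rewrite linearN memvN im_mon.
rewrite mon1_mul // (negbTE xD) !linearZ memvZ //= bd_mon //.
suff /eqP-> : mu (ext_bd K E (x |: D)) == 0 by apply: mem0v.
rewrite bias_of_eq0 //; apply/dep_rel_bd/coversP; split=> //.
case/setUP: CCL => [/imsetP[B /setIdP[BCL xB] eC]|/setIdP[CCL _]].
  exists B; split=> //; first by rewrite -(setD1K xB) -eC setUS.
  by apply: leq_trans C1 _; rewrite eC subset_leq_card // subD1set.
by exists C; split=> //; apply: subset_trans CD (subsetUr _ _).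
Qed.

End Projection.

Lemma exact_iff (i : 'Hom(Z', Z)) (p : 'Hom(Z, Z'')) :
  (forall a, i (mu' a) = mu (incl E a)) ->
  (forall a, p (mu a) = mu'' (res a)) ->
  split_exact i p <-> (forall y, [set x; y] \notin CL).
Proof.
move=> iE pE; split=> [[_ ex _ _] y|noCL]; last first.
  split; [exact: inclusion_inj | exact: projection_exact | exact: projection_surj |].
  exists (p^-1)%VF; apply/lfunP=> v; rewrite comp_lfunE id_lfunE limg_lfunVK //.
  by rewrite projection_surj // memvf.
apply/negP=> xyCL; have cxy := subsetP sCL _ xyCL.
have yE : y \in E by rewrite (subsetP (circuit_ground cxy)) // !inE eqxx orbT.
have yP : y \in P by rewrite !inE xyCL orbT.
have nyx : x != y.
  apply: contraTneq (cxy) => <-; rewrite setUid; apply/negP=> /circuit_dep.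
  by rewrite /indep sub1set xM rx cards1.
have yE' : [set y] \subset E' by rewrite subsetD1 !sub1set yE inE.
have : mu (ext_mon K E [set y]) \in lker p.
  by rewrite -ex -(incl_mon K E yE') -iE memv_img ?memvf.
rewrite memv_ker (bias_of_mon K exN) (projection_mon pE (y := y)) ?sub1set ?set11 //.
rewrite setDv scaler_eq0 (negbTE (projection_sign_neq0 _ _)) /= => /eqP.
rewrite -(bias_of_mon K exN'') => /eqP; rewrite bias_of_eq0 //.
exact/negP/dep_rel_proper.
Qed.

End MinorSequence.

(* Exactness at the middle term fails exactly when x lies in a two-element
   member {x, y} of CL: then p_x (i_x e_y) is 1 or -1 in the bias algebra of
   the contraction, which is nonzero. *)
Theorem theorem3p14 (K : fieldType) (n : nat) (M : matroid n)
    (CL : {set {set 'I_n}}) (hground : ground M = [set: 'I_n])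
    (hloop : loopfree M) (hCL : linear_class M CL) (x : 'I_n) (front : bool) :
  exists (i : 'Hom(bias_algebra K (delete M x) (lc_delete CL x),
                   bias_algebra K M CL))
         (p : 'Hom(bias_algebra K M CL,
                   bias_algebra K (contract M x) (lc_contract M CL x))),
    [/\ unique (@is_inclusion_map K n M CL x) i,
        unique (@is_projection_map K n M CL x front) p,
        lker i = 0%VS, limg p = fullv
      & split_exact i p <-> (forall y : 'I_n, [set x; y] \notin CL)].
Proof.
have lM := loopfreeP hloop; have xM : x \in ground M by rewrite hground inE.
have [i iE] := inclusion_exists K x hCL.
have [p pE] := projection_exists K front lM xM hCL.
exists i, p; split.
- exact: inclusion_unique iE.
- exact: projection_unique pE hground.
- exact: inclusion_inj iE.
- exact: projection_surj pE.
exact: exact_iff iE pE.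
Qed.
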